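(* Let $p\ge2$, $\alpha\ge0$, $\theta\in\mathbb R$ and $R>0$, and let $z_0$ be the first positive zero of the Bessel function $J_0$. Then for every $u\in C_c^\infty(B^d_R\setminus\{0\})$, \[ \int_{B^d_R}\frac{|\nabla_{\mathcal L}u|^p}{d^{p(\theta-1)}}|\nabla_{\mathcal L}d|^\alpha dx\ \ge\ \int_{B^d_R}\Big|\nabla_{\mathcal L}u\cdot\frac{\nabla_{\mathcal L}d}{|\nabla_{\mathcal L}d|}\Big|^p\frac{|\nabla_{\mathcal L}d|^\alpha}{d^{p(\theta-1)}}dx \] \[ \ge\Big|\frac{Q-p\theta}{p}\Big|^p\int_{B^d_R}\frac{|u|^p}{d^{p\theta}}|\nabla_{\mathcal L}d|^{\alpha+p}dx+\frac2p\Big|\frac{Q-p\theta}{p}\Big|^{p-2}\frac{z_0^2}{R^2}\int_{B^d_R}\frac{|u|^p}{d^{p\theta-2}}|\nabla_{\mathcal L}d|^{\alpha+p}dx. \]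
   Context: Vector fields and operators. On $\mathbb R^N$ take $h\le N$ vector fields $X_i=\sum_{j=1}^N\sigma_{i,j}\partial_{x_j}$ with $\sigma_{i,j},\partial_{x_j}\sigma_{i,j}\in C(\mathbb R^N)$. Let $\sigma=(\sigma_{i,j})$ and $\nabla_{\mathcal L}=(X_1,\dots,X_h)=\sigma\nabla$. Set $\operatorname{div}_{\mathcal L}Z=\operatorname{div}(\sigma^TZ)$ and $\mathcal L_pu=\operatorname{div}_{\mathcal L}(|\nabla_{\mathcal L}u|^{p-2}\nabla_{\mathcal L}u)$. Dilations. There are dilations $\delta_\lambda(x)=(\lambda^{\beta_1}x_1,\dots,\lambda^{\beta_N}x_N)$, $\beta_j>0$, with each $X_i$ homogeneous of degree one: $X_i(f\circ\delta_\lambda)=\lambda(X_if)\circ\delta_\lambda$. Set $Q=\sum_j\beta_j$. The function $d$. $d:\mathbb R^N\to[0,\infty)$ satisfies: (i) $d\in C(\mathbb R^N)\cap C^\infty(\mathbb R^N\setminus\{0\})$; (ii) $d(x)=0$ iff $x=0$; (iii) $d(\delta_\lambda x)=\lambda d(x)$; (iv) for every $p\ge2$, $\mathcal L_p(d^{(p-Q)/(p-1)})=0$ in $\mathbb R^N\setminus\{0\}$ if $p\neq Q$, and $\mathcal L_Q(-\ln d)=0$ there if $p=Q$. Balls. $B^d_R=\{d\le R\}$. *)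

(* Defs.v *)
From HB Require Import structures.
From mathcomp Require Import all_boot all_order all_algebra.
From mathcomp Require Import all_classical all_reals all_analysis.
Set Implicit Arguments. Unset Strict Implicit. Unset Printing Implicit Defensive.
Import Order.TTheory GRing.Theory Num.Theory.
Import numFieldNormedType.Exports.
Local Open Scope classical_set_scope.
Local Open Scope ring_scope.

Section Defs.
Variable R : realType.

Definition besselJ0 (x : R) : R :=
  limn (series (fun k : nat => (-1) ^+ k * (x / 2) ^+ (2 * k) / (k`!%:R) ^+ 2)).

Variable N : nat.
Notation pt := 'rV[R]_N.

Definition evec (j : 'I_N) : pt := delta_mx 0 j.
Definition pderiv (j : 'I_N) (f : pt -> R) (x : pt) : R := 'D_(evec j) f x.

Fixpoint iterD (vs : seq pt) (f : pt -> R) : pt -> R :=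
  match vs with
  | [::] => f
  | v :: vs' => 'D_v (iterD vs' f)
  end.
Definition smooth_on (U : set pt) (f : pt -> R) : Prop :=
  forall (vs : seq pt) (x : pt), U x -> differentiable (iterD vs f) x.

Definition csupp_in (U : set pt) (f : pt -> R) : Prop :=
  exists K : set pt, [/\ compact K, K `<=` U & forall x, ~ K x -> f x = 0].

Definition Cc_infty (U : set pt) (f : pt -> R) : Prop :=
  smooth_on setT f /\ csupp_in U f.

Variable h : nat.

Definition Xfield (sigma : 'I_h -> 'I_N -> pt -> R) (i : 'I_h) (f : pt -> R)
    (x : pt) : R := \sum_(j < N) sigma i j x * pderiv j f x.
Definition gradL (sigma : 'I_h -> 'I_N -> pt -> R) (f : pt -> R) (x : pt)
    : 'I_h -> R := fun i => Xfield sigma i f x.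

Definition enorm (v : 'I_h -> R) : R := Num.sqrt (\sum_(i < h) v i ^+ 2).
Definition edot (v w : 'I_h -> R) : R := \sum_(i < h) v i * w i.

Definition dil (beta : 'I_N -> R) (lam : R) (x : pt) : pt :=
  \row_j (lam `^ beta j * x 0 j).

(** Lebesgue integral on R^N, as the iterated integral of 1-dimensional
    Lebesgue integrals over all coordinates (Fubini--Tonelli). *)
Definition setcoord (k : nat) (t : R) (x : pt) : pt :=
  \row_j (if nat_of_ord j == k then t else x 0 j).
Fixpoint iint (k : nat) (f : pt -> \bar R) : pt -> \bar R :=
  match k with
  | 0 => f
  | k'.+1 => fun x =>
      (\int[@lebesgue_measure R]_(t in [set: R]) iint k' f (setcoord k' t x))%E
  end.
Definition integralRN (f : pt -> \bar R) : \bar R := iint N f 0.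
Definition integral_on (D : set pt) (f : pt -> R) : \bar R :=
  integralRN (fun x => if `[< D x >] then (f x)%:E else 0%E).

(** L_p v = 0 in U (weak sense): for every test function phi in C_c^infty(U),
    int |grad_L v|^(p-2) grad_L v . grad_L phi dx = 0 *)
Definition Lp_harmonic (sigma : 'I_h -> 'I_N -> pt -> R) (p : R) (U : set pt)
    (v : pt -> R) : Prop :=
  forall phi : pt -> R, Cc_infty U phi ->
    integral_on setT (fun x => enorm (gradL sigma v x) `^ (p - 2) *
                               edot (gradL sigma v x) (gradL sigma phi x)) = 0%E.

End Defs.

(* Main.v *)
Require Import Defs.
From HB Require Import structures.
From mathcomp Require Import all_boot all_order all_algebra.
From mathcomp Require Import all_classical all_reals all_analysis.
From mathcomp Require Import ring lra.
Import Order.TTheory GRing.Theory Num.Theory.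
Import numFieldNormedType.Exports.
Local Open Scope classical_set_scope.
Local Open Scope ring_scope.

(** Put [kap = (Q - p theta) / p] and [q = p + alpha].  Hypothesis (iv) for the
    exponent [q] says that the field [d ^ (1 - Q) |grad d| ^ (q - 2) grad d] is
    divergence free away from the origin; it is tested with
    [G(d) |u| ^ p], where [G(r) = r ^ (p kap) (r E(r) - kap)] and
    [E = (2 / p) psi' / psi], [psi(r) = J_0(k r)] for some [k < z0 / Rad], so that
    [psi] has no zero on [0 < r <= Rad].  Bessel's equation is used only as the
    Riccati equation [E' = - E / r - (p / 2) E ^ 2 - (2 / p) k ^ 2].

    The vanishing integral is then compared pointwise with the two sides.  With
    [x = d (grad u . n)], [y = u |grad d|] and [b = - kap y], where [n] is the
    direction of [grad d], everything reduces to
    [|x| ^ p >= |b| ^ p + p |b| ^ (p - 2) b (x - b) + (p / 2) |b| ^ (p - 2) (x - b) ^ 2],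
    which is Young's inequality, and to completing the square with [d E y].
    Finally [k] tends to [z0 / Rad].

    As [|u| ^ p] is not smooth, it is first replaced by
    [(u ^ 2 + del ^ 2) ^ (p / 2) - (del ^ 2) ^ (p / 2)] with [del > 0]. *)

Set Implicit Arguments.
Unset Strict Implicit.

(** * Bessel's equation *)


Section Bessel.
Context {R : realType}.
Implicit Types (c : nat -> R) (x y : R).

Lemma is_cvg_pseries_le_exp c x :
  (forall i, `|c i| <= (i`!%:R)^-1) -> cvgn (pseries c x).
Proof.
move=> cE; apply: normed_cvg.
apply: (@series_le_cvg _ _ (exp_coeff `|x|)) => [n|n|n|].
- exact: normr_ge0.
- by rewrite /exp_coeff /= mulr_ge0 ?exprn_ge0 ?invr_ge0.
- rewrite /= normrM normrX mulrC /exp_coeff /=.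
  by apply: ler_wpM2l => //; rewrite exprn_ge0.
- exact: is_cvg_series_exp_coeff.
Qed.

(** The factor [i + 1] created by differentiation is absorbed by the factorial. Stability of the
    bound lets termwise differentiation be repeated. *)
Lemma pseries_diffs_le_exp c : (forall i, `|c i| <= (i`!%:R)^-1) ->
  forall i, `|pseries_diffs c i| <= (i`!%:R)^-1.
Proof.
move=> cE i; rewrite /pseries_diffs normrM normr_nat.
apply: le_trans (ler_wpM2l _ (cE i.+1)) _ => //.
by rewrite factS natrM invfM mulrA divff ?mul1r// pnatr_eq0.
Qed.

Lemma is_derive_pseries_le_exp c x : (forall i, `|c i| <= (i`!%:R)^-1) ->
  is_derive x 1 (fun y => limn (pseries c y)) (limn (pseries (pseries_diffs c) x)).
Proof.
move=> cE; have c'E := pseries_diffs_le_exp cE.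
have c''E := pseries_diffs_le_exp c'E.
apply: (@pseries_snd_diffs _ _ (`|x| + 1)).
- exact: is_cvg_pseries_le_exp.
- exact: is_cvg_pseries_le_exp.
- exact: is_cvg_pseries_le_exp.
- by rewrite [ltRHS]ger0_norm ?addr_ge0// ltrDl.
Qed.

(** Coefficients of the entire function F with [J_0(x) = F((x / 2)^2)]; working with F avoids a
    series in even powers only. *)
Definition besselc (k : nat) : R := (-1) ^+ k / (k`!%:R) ^+ 2.
Definition besselF x : R := limn (pseries besselc x).
Definition besselF' x : R := limn (pseries (pseries_diffs besselc) x).

Lemma besselJ0E x : besselJ0 x = besselF ((x / 2) ^+ 2).
Proof.
rewrite /besselJ0 /besselF /pseries; congr (limn (series _)).
by apply/funext => k; rewrite /besselc exprM mulrAC.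
Qed.

Lemma besselc_le_exp i : `|besselc i| <= (i`!%:R)^-1.
Proof.
rewrite /besselc normrM normrX normrN1 expr1n mul1r ger0_norm ?invr_ge0 ?sqr_ge0//.
have f1 : (1 : R) <= i`!%:R by rewrite ler1n fact_gt0.
rewrite lef_pV2 ?posrE ?exprn_gt0 ?(lt_le_trans _ f1)//.
by rewrite expr2 ler_peMl// (le_trans _ f1).
Qed.

Lemma is_derive_besselF x : is_derive x 1 besselF (besselF' x).
Proof. exact: is_derive_pseries_le_exp besselc_le_exp. Qed.

(* [besselF] solves y F'' + F' + F = 0: the coefficients satisfy
   (k + 1) ^ 2 c_(k + 1) + c_k = 0. *)
Lemma is_derive_besselF' x : x != 0 ->
  is_derive x 1 besselF' (- (besselF' x + besselF x) / x).
Proof.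
move=> x0; have c'E := pseries_diffs_le_exp besselc_le_exp.
have c''E := pseries_diffs_le_exp c'E.
suff <- : limn (pseries (pseries_diffs (pseries_diffs besselc)) x) =
  - (besselF' x + besselF x) / x by exact: is_derive_pseries_le_exp.
set S2 := pseries _ x; set S1 := pseries (pseries_diffs besselc) x.
set S0 := pseries besselc x.
have cS2 : S2 @ \oo --> limn S2 by exact: is_cvg_pseries_le_exp.
have cS1 : S1 n.+1 @[n --> \oo] --> besselF' x.
  rewrite (_ : (fun n => S1 n.+1) = [sequence S1 n.+1]_n)//.
  by rewrite cvg_shiftS; exact: is_cvg_pseries_le_exp.
have cS0 : S0 n.+1 @[n --> \oo] --> besselF x.
  rewrite (_ : (fun n => S0 n.+1) = [sequence S0 n.+1]_n)//.
  by rewrite cvg_shiftS; apply: is_cvg_pseries_le_exp; exact: besselc_le_exp.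
(* The equation already holds for partial sums: multiplying by [x] raises degrees by one, hence
   [n.+1] on the right, and the extra constant term is [c_1 + c_0 = 0]. *)
have S2E : S2 = (fun n => - (S1 n.+1 + S0 n.+1) / x).
  apply/funext => n; apply: (mulIf x0); rewrite divfK//.
  apply/eqP; rewrite -addr_eq0 /S2 /S1 /S0 /pseries /series /=.
  rewrite -big_split/= big_nat_recl//= addrCA mulr_suml -big_split/=.
  have c0 : pseries_diffs besselc 0 * x ^+ 0 + besselc 0 * x ^+ 0 = 0.
    by rewrite /pseries_diffs /besselc !expr0 !mulr1 !fact0 factS fact0; lra.
  rewrite c0 add0r; apply/eqP; apply: big1 => i _.
  rewrite /pseries_diffs [in LHS]/besselc !factS !natrM !exprSr.
  have f0 : (i`!%:R : R) != 0 by rewrite pnatr_eq0 -lt0n fact_gt0.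
  have i0 : (i.+1%:R : R) != 0 by rewrite pnatr_eq0.
  have i1 : (i.+2%:R : R) != 0 by rewrite pnatr_eq0.
  by field; rewrite f0 nat1r i0 -(natrD _ 2 i) add2n i1.
have : S2 @ \oo --> - (besselF' x + besselF x) / x.
  by rewrite S2E; apply: cvgMl; apply: cvgN; exact: cvgD.
by move/(cvg_lim (@Rhausdorff R)).
Qed.

(* E = (2 / p) psi' / psi with psi(r) = J_0(k r). *)
Lemma bessel_riccati (p k z0 : R) : 0 < p -> 0 < k ->
  (forall x, 0 < x < z0 -> besselJ0 x != 0) ->
  exists E : R -> R, forall r, 0 < r < z0 / k ->
    is_derive r 1 E (- (E r / r) - p / 2 * E r ^+ 2 - 2 / p * k ^+ 2).
Proof.
move=> p0 k0 hJ; pose y r : R := (k * r / 2) ^+ 2.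
(* Since [psi(r) = F((k r / 2)^2)], the chain rule gives [psi' = (k^2 r / 2) F'], whence the factor
   [k^2 r / p]. *)
exists (fun r => k ^+ 2 * r / p * (besselF' (y r) / besselF (y r))) => r /andP[r0 rz].
have F0 : besselF (y r) != 0.
  rewrite -besselJ0E hJ// mulr_gt0//=.
  by rewrite mulrC -ltr_pdivlMr.
have y0 : y r != 0 by rewrite expf_neq0// !mulf_neq0 ?gt_eqF// ?invr_gt0.
have dy : is_derive r 1 y (k ^+ 2 * r / 2).
  have -> : y = (fun r => (k / 2) ^+ 2 * (r * r)).
    by apply/funext => s; rewrite /y; field.
  apply: is_derive_eq; rewrite /GRing.scale/=; by field.
have dF : is_derive r 1 (besselF \o y) (k ^+ 2 * r / 2 * besselF' (y r)).
  rewrite mulrC; exact: (is_derive1_comp (is_derive_besselF _) dy).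
have dF' : is_derive r 1 (besselF' \o y)
    (k ^+ 2 * r / 2 * (- (besselF' (y r) + besselF (y r)) / y r)).
  rewrite mulrC; exact: (is_derive1_comp (is_derive_besselF' y0) dy).
have dFV := @is_deriveV _ (besselF \o y) r _ 1 F0 dF.
have dl : is_derive r 1 (fun r => k ^+ 2 * r / p) (k ^+ 2 / p).
  by apply: is_derive_eq; rewrite /GRing.scale/=; field; rewrite gt_eqF.
apply: (is_derive_eq (is_deriveM dl (is_deriveM dF' dFV))).
rewrite /GRing.scale/=.
have yE : y r = k ^+ 2 * r ^+ 2 / 4 by rewrite /y; field.
move: F0 y0; set a := besselF _; set b := besselF' _ => F0 y0.
rewrite /GRing.scale /= /comp -/a -/b yE [X in X * (k ^+ 2 / p)](_ : _ = b / a)//.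
by field; rewrite F0 !gt_eqF.
Qed.
End Bessel.

(** * Iterated integrals of continuous functions *)


Section IntegralMonotone.
Local Open Scope ereal_scope.

(** For nonnegative functions the integral is a supremum over the simple functions below, so
    arbitrary functions can be compared; the general case splits into positive and negative parts.
    This matters because the unit direction of [grad d] may jump where [grad d] vanishes. *)
Lemma le_integral_pointwise d (T : measurableType d) (R : realType)
    (mu : {measure set T -> \bar R}) (f g : T -> \bar R) :
  (forall x, f x <= g x) -> \int[mu]_x f x <= \int[mu]_x g x.
Proof.
have ge0_le (u v : T -> \bar R) : (forall x, 0 <= u x) ->
    (forall x, u x <= v x) -> \int[mu]_x u x <= \int[mu]_x v x.
  move=> u0 uv; have v0 x : 0 <= v x by rewrite (le_trans (u0 x)).
  rewrite !ge0_integralTE//; apply: ereal_sup_le => _ [h /= hu <-].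
  by exists h => //= x; exact: le_trans (uv x).
move=> fg; rewrite [leLHS]integralE [leRHS]integralE; apply: leeB.
  by apply: ge0_le => x; [exact: funepos_ge0|rewrite !funeposE ge_max !le_max fg lexx !orbT].
by apply: ge0_le => x; [exact: funeneg_ge0|rewrite !funenegE ge_max !le_max leeN2 fg lexx !orbT].
Qed.

Lemma le_iint (R : realType) (N : nat) k (f g : 'rV[R]_N -> \bar R) :
  (forall x, f x <= g x) -> forall x, iint k f x <= iint k g x.
Proof.
move=> fg; elim: k => [|k IH] x //=.
by apply: le_integral_pointwise => t; exact: IH.
Qed.
End IntegralMonotone.

Section CompactParameterIntegral.
Context {R : realType} {S : topologicalType}.
Notation mu := (@lebesgue_measure R).
Variables (F : S * R -> R) (M : R).
Hypothesis cF : continuous F.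
Hypothesis FM : forall s t, M < `|t| -> F (s, t) = 0.

Let continuous_slice s : continuous (fun t => F (s, t)).
Proof.
move=> t; apply: (@continuous_comp _ _ _ (fun t => (s, t)) F); last exact: cF.
exact: (cvg_pair (cvg_cst _) (@cvg_id _ _)).
Qed.

Let slice_restrict s : (fun t => (F (s, t))%:E) = (fun t => (F (s, t))%:E) \_ `[- M, M].
Proof.
apply/funext => t; rewrite /patch; case: ifPn => //.
rewrite notin_setE/= in_itv/= -ler_norml => /negP; rewrite -ltNge => Mt.
by rewrite FM.
Qed.

Let integrable_slice_itv s : mu.-integrable `[- M, M] (fun t => (F (s, t))%:E).
Proof.
apply: (@continuous_compact_integrable R (fun t => F (s, t))).
  exact: segment_compact.
exact: continuous_subspaceT.
Qed.

Lemma integrable_slice s : mu.-integrable setT (fun t => (F (s, t))%:E).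
Proof.
rewrite slice_restrict; apply/integrable_restrict => //=.
by rewrite setTI.
Qed.

(** Compactness of [[-M, M]] makes continuity in [s] uniform in [t]; the integrals then differ by at
    most the uniform error times the length of the interval. *)
Lemma continuous_Rintegral_slice :
  continuous (fun s => \int[mu]_(t in setT) F (s, t)).
Proof.
have sliceE s : \int[mu]_(t in setT) F (s, t) = \int[mu]_(t in `[- M, M]) F (s, t).
  by rewrite /Rintegral [in RHS]integral_mkcond -slice_restrict.
move=> s0; apply/cvgrPdist_le => e e0.
(* The interval has length at most [2 |M|]; the added 1 keeps the denominator positive. *)
pose e' := e / (2 * `|M| + 1).
have e'0 : 0 < e' by rewrite divr_gt0// ltr_wpDl// mulr_ge0.
have near_unif : \forall s \near s0,
    `[- M, M]%classic `<=` [set t | `|F (s0, t) - F (s, t)| <= e'].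
  apply: (@compact_near_coveringP _ `[- M, M]%classic).1; first exact: segment_compact.
  move=> t _.
  have H1 : \forall z \near (s0, t), `|F (s0, t) - F z| < e' / 2.
    by have /cvgrPdist_lt := @cF (s0, t); apply; rewrite divr_gt0.
  have H2 : \forall t' \near t, `|F (s0, t) - F (s0, t')| < e' / 2.
    by have /cvgrPdist_lt := @continuous_slice s0 t; apply; rewrite divr_gt0.
  case: H1 => -[A B] [/= As Bt] AB.
  exists (B `&` [set t' | `|F (s0, t) - F (s0, t')| < e' / 2], A) => /=.
    by split => //; exact: filterI.
  move=> [t' s] [/= [Bt' H2'] As']; have := AB (s, t') (conj As' Bt') => /= H1'.
  rewrite (_ : _ - _ = (F (s0, t) - F (s, t')) - (F (s0, t) - F (s0, t'))); last by ring.
  rewrite (le_trans (ler_normB _ _))// [leRHS](splitr e').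
  by apply: lerD; exact: ltW.
near=> s.
have le_e' : `[- M, M]%classic `<=` [set t | `|F (s0, t) - F (s, t)| <= e'] by near: s.
rewrite !sliceE.
have mM : measurable (`[- M, M]%classic : set R) by exact: measurable_itv.
rewrite -(@RintegralB _ _ _ mu _ (fun t => F (s0, t)) (fun t => F (s, t)) mM
  (integrable_slice_itv s0) (integrable_slice_itv s)).
have iB : mu.-integrable `[- M, M] (fun t => (F (s0, t) - F (s, t))%:E).
  have := @integrableB _ _ _ mu _ (measurable_itv _) _ _ (integrable_slice_itv s0) (integrable_slice_itv s).
  by apply: eq_integrable => //= t _; rewrite EFinB.
apply: (le_trans (le_normr_Rintegral _ _)) => //.
have ic : mu.-integrable `[- M, M] (EFin \o (fun=> e')).
  apply: (@continuous_compact_integrable R); first exact: segment_compact.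
  by apply: continuous_subspaceT => ?; exact: cvg_cst.
apply: (@le_trans _ _ (\int[mu]_(t in `[- M, M]) e')).
  by apply: le_Rintegral => //; exact: integrable_norm.
rewrite Rintegral_cst//.
have -> : fine (mu `[- M, M]) = if - M < M then M + M else 0.
  have /= -> := @lebesgue_measure_itv R `[- M, M].
  by rewrite lte_fin; case: ifP => //= _; rewrite opprK.
case: ifPn => [Mlt|_]; last by rewrite mulr0 ltW.
rewrite /e' mulrAC ler_pdivrMr ?ltr_wpDl ?mulr_ge0//.
apply: ler_wpM2l; first exact: ltW.
by have := ler_norm M; lra.
Unshelve. all: by end_near. Qed.
End CompactParameterIntegral.

Section SuccessiveIntegrals.
Context {R : realType} {N : nat} {T : topologicalType}.
Notation pt := 'rV[R]_N.
Notation mu := (@lebesgue_measure R).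
Implicit Types (f g : T * pt -> R) (M : R).

Lemma continuous_setcoord k :
  continuous (fun z : (T * pt) * R => (z.1.1, setcoord k z.2 z.1.2)).
Proof.
move=> w; have cfst (A B : topologicalType) : continuous (@fst A B).
  by move=> z; exact: cvg_fst.
have csnd (A B : topologicalType) : continuous (@snd A B).
  by move=> z; exact: cvg_snd.
have c11 := @continuous_comp _ _ _ fst fst w (@cfst _ _ _) (@cfst T pt _).
have c12 := @continuous_comp _ _ _ fst snd w (@cfst _ _ _) (@csnd T pt _).
suff c2 : (fun z : (T * pt) * R => setcoord k z.2 z.1.2) @ nbhs w --> setcoord k w.2 w.1.2.
  exact: (cvg_pair c11 c2).
move=> A [P nP PA] /=.
apply: (@filterS _ _ _ [set z | forall i j, P i j (setcoord k z.2 z.1.2 i j)]).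
  by move=> z Pz; exact: PA.
suff H i j : (\forall z \near w, P i j (setcoord k z.2 z.1.2 i j)).
  exact: (@filter_forall _ _ _ _ (nbhs_filter w)
    (fun i => @filter_forall _ _ _ _ (nbhs_filter w) (H i))).
have := nP i j; rewrite !mxE; case: ifP => jk Pij.
  by apply: (@filterS _ _ (nbhs_filter w) _ _ _ (@csnd _ _ w _ Pij)) => z /=; rewrite mxE jk.
have := @continuous_comp _ _ _ _ (fun y : pt => y 0 j) w c12 (@coord_continuous _ _ _ 0 j _).
by move=> /(_ _ Pij) H; apply: (@filterS _ _ (nbhs_filter w) _ _ _ H) => z /=; rewrite mxE jk.
Qed.

(** Real-valued counterpart of [iint] that carries a parameter from [T] along, so that one induction
    gives continuity in the parameter and in the coordinates. *)
Fixpoint Riint (k : nat) f : T * pt -> R :=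
  if k is k'.+1 then
    fun z => \int[mu]_(t in setT) Riint k' f (z.1, setcoord k' t z.2)
  else f.

(** Only coordinates from [k] on are tested, because the earlier ones have been integrated out after
    [k] steps. *)
Definition boxed M k f :=
  forall z : T * pt, (exists2 j : 'I_N, (k <= j)%N & M < `|z.2 0 j|) -> f z = 0.

(** Coordinate [k] is integrated next, and [boxed] confines it to [[-M, M]], so continuity survives
    each integration. *)
Lemma Riint_boxed_continuous M f k : (k <= N)%N -> continuous f -> boxed M 0 f ->
  continuous (Riint k f) /\ boxed M k (Riint k f).
Proof.
move=> + cf bf; elim: k => [//|k IH] kN.
have [cJ bJ] := IH (ltnW kN); split => /=.
  pose F (w : (T * pt) * R) := Riint k f (w.1.1, setcoord k w.2 w.1.2).
  apply: (@continuous_Rintegral_slice _ _ F M).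
    by move=> w; apply: continuous_comp; [exact: continuous_setcoord|exact: cJ].
  move=> s t Mt; apply: bJ; exists (Ordinal kN) => //=.
  by rewrite mxE eqxx.
move=> z [j kj Mj]; rewrite (@eq_Rintegral _ _ _ _ _ (fun=> 0)).
  by rewrite Rintegral_cst// mul0r.
move=> t _; apply: bJ; exists j; first exact: ltnW.
by rewrite mxE gtn_eqF.
Qed.

Lemma integrable_Riint M f k z : (k < N)%N -> continuous f -> boxed M 0 f ->
  mu.-integrable setT (fun t => (Riint k f (z.1, setcoord k t z.2))%:E).
Proof.
move=> kN cf bf; have [cJ bJ] := Riint_boxed_continuous (ltnW kN) cf bf.
pose F (w : (T * pt) * R) := Riint k f (w.1.1, setcoord k w.2 w.1.2).
apply: (@integrable_slice _ _ F M).
  by move=> w; apply: continuous_comp; [exact: continuous_setcoord|exact: cJ].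
move=> s t Mt; apply: bJ; exists (Ordinal kN) => //=.
by rewrite mxE eqxx.
Qed.

Lemma iintE M f k tau x : (k <= N)%N -> continuous f -> boxed M 0 f ->
  iint k (fun x => (f (tau, x))%:E) x = (Riint k f (tau, x))%:E.
Proof.
move=> + cf bf; elim: k x => [//|k IH] x kN /=.
under eq_integral do rewrite (IH _ (ltnW kN)).
rewrite /Rintegral fineK//; apply: integrable_fin_num => //.
exact: (@integrable_Riint M f k (tau, x)).
Qed.

Lemma Riint_linear M f g (a b : R) k z : (k <= N)%N ->
  continuous f -> continuous g -> boxed M 0 f -> boxed M 0 g ->
  Riint k (fun z => a * f z + b * g z) z = a * Riint k f z + b * Riint k g z.
Proof.
move=> + cf cg bf bg; elim: k z => [//|k IH] z kN /=.
under eq_Rintegral do rewrite (IH _ (ltnW kN)).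
have iJf := integrable_Riint z kN cf bf.
have iJg := integrable_Riint z kN cg bg.
rewrite RintegralD//; [|exact: (integrableZl measurableT a iJf)|exact: (integrableZl measurableT b iJg)].
by rewrite !RintegralZl.
Qed.

End SuccessiveIntegrals.

Section CompactSupport.
Context {R : realType} {N : nat}.
Notation pt := 'rV[R]_N.

Lemma compact_boxed (K : set pt) : compact K ->
  exists M, forall x : pt, (exists j : 'I_N, M < `|x 0 j|) -> ~ K x.
Proof.
move=> /compact_bounded[M [Mr KM]]; exists (M + 1) => x [j Mj] Kx.
have := KM (M + 1) _ x Kx; rewrite ltrDl ltr01 => /(_ isT) /=.
rewrite leNgt => /negP; apply; apply: (lt_le_trans Mj).
rewrite [`|x|]mx_normrE; apply: le_trans (le_bigmax _ _ (0, j)).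
by [].
Qed.

Variable K : set pt.
Hypothesis cK : compact K.

(** Serves the limit in which the regularization parameter [del] tends to 0. *)
Lemma continuous_parameter_integral (T : topologicalType) (f : T * pt -> R) :
  continuous f -> (forall z, ~ K z.2 -> f z = 0) ->
  exists G : T -> R, continuous G /\
    forall tau, integralRN (fun x => (f (tau, x))%:E) = (G tau)%:E.
Proof.
move=> cf fK; have [M KM] := compact_boxed cK.
have bf : boxed M 0 f by move=> z [j _ Mj]; apply: fK; apply: KM; exists j.
have [cJ _] := Riint_boxed_continuous (leqnn N) cf bf.
exists (fun tau => Riint N f (tau, 0)); split; last first.
  by move=> tau; exact: (@iintE _ _ _ M).
move=> tau; apply: (@continuous_comp T (T * pt)%type R (fun tau => (tau, 0)) (Riint N f)); last exact: cJ.
exact: (cvg_pair (@cvg_id _ _) (cvg_cst _)).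
Qed.

Lemma integralRN_linear (f g : pt -> R) (a b : R) :
  continuous f -> continuous g ->
  (forall x, ~ K x -> f x = 0) -> (forall x, ~ K x -> g x = 0) ->
  exists If Ig : R, [/\ integralRN (EFin \o f) = If%:E,
    integralRN (EFin \o g) = Ig%:E &
    integralRN (fun x => (a * f x + b * g x)%:E) = (a * If + b * Ig)%:E].
Proof.
move=> cf cg fK gK; have [M KM] := compact_boxed cK.
(* A dummy real parameter brings the functions into the form expected by [Riint]. *)
pose lift (u : pt -> R) (z : R * pt) := u z.2.
have clift u : continuous u -> continuous (lift u).
  by move=> cu z; apply: (@continuous_comp _ _ _ snd u); [exact: cvg_snd|exact: cu].
have blift u : (forall x, ~ K x -> u x = 0) -> boxed M 0 (lift u).
  by move=> uK z [j _ Mj]; apply: uK; apply: KM; exists j.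
exists (Riint N (lift f) (0, 0)), (Riint N (lift g) (0, 0)); split.
- exact: (@iintE _ _ _ M (lift f) N 0 0 (leqnn N) (clift _ cf) (blift _ fK)).
- exact: (@iintE _ _ _ M (lift g) N 0 0 (leqnn N) (clift _ cg) (blift _ gK)).
- pose h x := a * f x + b * g x.
  have ch : continuous h.
    by move=> x; exact: (cvgD (cvgMl_tmp (cf x)) (cvgMl_tmp (cg x))).
  have hK x : ~ K x -> h x = 0 by move=> Kx; rewrite /h fK// gK// !mulr0 addr0.
  rewrite [LHS](@iintE _ _ _ M (lift h) N 0 0 (leqnn N) (clift _ ch) (blift _ hK)).
  congr EFin; apply: (@Riint_linear _ _ _ M (lift f) (lift g)) => //.
  + exact: clift.
  + exact: clift.
  + exact: blift.
  + exact: blift.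
Qed.
End CompactSupport.

(** * Smooth functions *)



(** The differential of [f] serves for [g] as well, since the little-o expansion at [x] only sees a
    neighbourhood. *)
Lemma near_eq_differentiable (K : numFieldType) (V W : normedModType K)
  (f g : V -> W) (x : V) : (\near x, f x = g x) ->
  differentiable f x -> differentiable g x.
Proof.
move=> fg df; have gE : g x = f x by rewrite (nbhs_singleton fg).
have fgs : nbhs (0 : V) [set h | f (h + x) = g (h + x)].
  have cs : {for (0 : V), continuous (fun h : V => h + x)}.
    exact: (cvgD (@cvg_id _ _) (cvg_cst _)).
  have fg0 : nbhs (0 + x) [set y | f y = g y] by rewrite add0r.
  exact: (cs _ fg0).
have gdf : g \o shift x = cst (g x) + 'd f x +o_ 0 id.
  apply/eqaddoP => e e0; have /eqaddoP/(_ e e0) := diff_locally df.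
  by apply: filterS2 fgs => h /= fgh; rewrite !fctE/= -fgh gE.
apply/diff_locallyP; rewrite (diff_unique (diff_continuous df) gdf); split => //; exact: diff_continuous.
Qed.

Section SmoothFunctions.
Context {R : realType} {N : nat}.
Notation pt := 'rV[R]_N.
Implicit Types (U V : set pt) (f g : pt -> R) (v x : pt) (F G : R -> R).

Lemma open_near_eq U f g x : open U -> (forall y, U y -> f y = g y) -> U x ->
  \near x, f x = g x.
Proof.
move=> oU fg Ux; apply: (@filterS _ _ (nbhs_filter x) U); last exact: open_nbhs_nbhs.
exact: fg.
Qed.

Lemma iterD_rcons v vs f : Defs.iterD (rcons vs v) f = Defs.iterD vs ('D_v f).
Proof. by elim: vs => //= w vs ->. Qed.

Lemma smooth_on_differentiable U f x : smooth_on U f -> U x -> differentiable f x.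
Proof. by move=> sf Ux; exact: (sf [::] x Ux). Qed.

Lemma smooth_on_derive U f v : smooth_on U f -> smooth_on U ('D_v f).
Proof. by move=> sf vs x Ux; rewrite -iterD_rcons; exact: sf. Qed.

Lemma derive_comp1 F f x v a : differentiable f x -> is_derive (f x) 1 F a ->
  'D_v (F \o f) x = a * 'D_v f x.
Proof.
move=> df dF; have dF' : derivable F (f x) 1 by case: dF.
have dF'' : differentiable F (f x) by apply/derivable1_diffP.
rewrite deriveE; last exact: differentiable_comp.
rewrite diff_comp//= deriv1E// derive1E -deriveE//.
by case: dF => _ ->; rewrite mulrC.
Qed.

Inductive gen_alg (B : (R -> R) -> Prop) : (R -> R) -> Prop :=
| gen_base F : B F -> gen_alg B F
| gen_cst c : gen_alg B (fun=> c)
| gen_add F G : gen_alg B F -> gen_alg B G -> gen_alg B (fun r => F r + G r)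
| gen_mul F G : gen_alg B F -> gen_alg B G -> gen_alg B (fun r => F r * G r).

(** With two classes, derivatives of generators may fall into the algebra that they generate.
    Derivatives are controlled only on [I], because real powers and [E] may be singular
    elsewhere. *)
Definition derive_closed (I : set R) (B C : (R -> R) -> Prop) :=
  forall F, B F -> exists F', C F' /\ forall r, I r -> is_derive r 1 F (F' r).

Lemma gen_alg_derive_closed I B :
  derive_closed I B (gen_alg B) -> derive_closed I (gen_alg B) (gen_alg B).
Proof.
move=> dB F; elim=> {F} [F /dB//|c|F G gF [F' [gF' dF]] gG [G' [gG' dG]]|F G gF [F' [gF' dF]] gG [G' [gG' dG]]].
- by exists (fun=> 0); split; [exact: gen_cst|move=> r _; exact: is_derive_cst].
- exists (fun r => F' r + G' r); split; first exact: gen_add.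
  by move=> r Ir; have := dF r Ir; have := dG r Ir => ? ?; exact: is_deriveD.
- exists (fun r => F r * G' r + G r * F' r); split.
    by apply: gen_add; apply: gen_mul.
  by move=> r Ir; have := dF r Ir; have := dG r Ir => ? ?; exact: is_deriveM.
Qed.

(* Unlike the compositions alone, this class is stable under ['D_v]. *)
Inductive gen_smooth U (I : set R) (C : (R -> R) -> Prop) : (pt -> R) -> Prop :=
| gs_smooth f : smooth_on U f -> gen_smooth U I C f
| gs_add f g : gen_smooth U I C f -> gen_smooth U I C g ->
    gen_smooth U I C (fun x => f x + g x)
| gs_mul f g : gen_smooth U I C f -> gen_smooth U I C g ->
    gen_smooth U I C (fun x => f x * g x)
| gs_comp F f : C F -> smooth_on U f -> (forall x, U x -> I (f x)) ->
    gen_smooth U I C (F \o f).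

Lemma gen_smooth_differentiable U I C f x : derive_closed I C C ->
  gen_smooth U I C f -> U x -> differentiable f x.
Proof.
move=> dC gf Ux; elim: gf => {f} [f sf|f g _ df _ dg|f g _ df _ dg|F f CF sf If].
- exact: smooth_on_differentiable sf Ux.
- exact: differentiableD.
- exact: differentiableM.
- apply: differentiable_comp; first exact: smooth_on_differentiable sf Ux.
  have [F' [_ dF]] := dC F CF; apply/derivable1_diffP.
  by have := dF _ (If x Ux); case.
Qed.

Lemma gen_smooth_derive U I C f v : derive_closed I C C ->
  gen_smooth U I C f ->
  exists g, gen_smooth U I C g /\ forall x, U x -> 'D_v f x = g x.
Proof.
move=> dC; elim=> {f} [f sf|f g gf [f' [gf' df]] gg [g' [gg' dg]]
    |f g gf [f' [gf' df]] gg [g' [gg' dg]]|F f CF sf If].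
- by exists ('D_v f); split => //; exact/gs_smooth/smooth_on_derive.
- exists (fun x => f' x + g' x); split; first exact: gs_add.
  move=> x Ux; rewrite -df// -dg// -deriveD//; apply: diff_derivable;
    exact: gen_smooth_differentiable dC _ Ux.
- exists (fun x => f x * g' x + g x * f' x); split.
    by apply: gs_add; apply: gs_mul.
  move=> x Ux; rewrite -df// -dg// -[LHS]/('D_v (f * g) x) deriveM//; apply: diff_derivable;
    exact: gen_smooth_differentiable dC _ Ux.
- have [F' [CF' dF]] := dC F CF; exists (fun x => F' (f x) * 'D_v f x); split.
    by apply: gs_mul; [exact: (@gs_comp _ _ _ F')|exact/gs_smooth/smooth_on_derive].
  move=> x Ux.
  by rewrite (derive_comp1 v (smooth_on_differentiable sf Ux) (dF _ (If x Ux))).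
Qed.

Lemma iterD_near_eq U f g vs x : open U -> (forall y, U y -> f y = g y) ->
  U x -> Defs.iterD vs f x = Defs.iterD vs g x.
Proof.
move=> oU fg; elim: vs x => [|v vs IH] x Ux; first exact: fg.
by apply: near_eq_derive; exact: (open_near_eq oU IH Ux).
Qed.

Lemma smooth_on_eq U f g : open U -> (forall y, U y -> f y = g y) ->
  smooth_on U f -> smooth_on U g.
Proof.
move=> oU fg sf vs x Ux; apply: near_eq_differentiable (sf vs x Ux).
by apply: (open_near_eq oU _ Ux) => y Uy; exact: (iterD_near_eq _ oU).
Qed.

(** By induction on the directions, each iterated derivative agrees on [U] with a member of the
    class; openness of [U] allows this agreement to be differentiated again. *)
Lemma smooth_on_gen U I C f : open U -> derive_closed I C C ->
  gen_smooth U I C f -> smooth_on U f.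
Proof.
move=> oU dC gf vs.
have [g [gg fg]] : exists g, gen_smooth U I C g /\
    forall x, U x -> Defs.iterD vs f x = g x.
  elim: vs => [|v vs [g [gg fg]]]; first by exists f.
  have [g' [gg' gE]] := gen_smooth_derive v dC gg.
  exists g'; split => // x Ux /=; rewrite -gE//.
  by apply: near_eq_derive; exact: (open_near_eq oU fg Ux).
move=> x Ux; apply: near_eq_differentiable (gen_smooth_differentiable dC gg Ux).
by apply: (open_near_eq oU _ Ux) => y Uy; rewrite fg.
Qed.

Lemma smooth_on_comp U I C F f : open U -> derive_closed I C C -> C F ->
  smooth_on U f -> (forall x, U x -> I (f x)) -> smooth_on U (F \o f).
Proof.
by move=> oU dC CF sf If; apply: (smooth_on_gen oU dC); exact: gs_comp.
Qed.

Lemma smooth_on_mul U f g : open U -> smooth_on U f -> smooth_on U g ->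
  smooth_on U (fun x => f x * g x).
Proof.
(* With an empty class of outer functions, closure under derivatives is vacuous and only sums and
   products of smooth functions remain. *)
move=> oU sf sg; apply: (@smooth_on_gen U setT (fun=> False)) => //.
by apply: gs_mul; exact: gs_smooth.
Qed.

Lemma smooth_on_cst0 U : smooth_on U (fun=> 0).
Proof.
move=> vs x _; rewrite (_ : Defs.iterD vs _ = cst 0); first exact: differentiable_cst.
by elim: vs => //= v vs ->; apply/funext => y; rewrite derive_cst.
Qed.

Lemma smooth_on_setU U V f : smooth_on U f -> smooth_on V f ->
  smooth_on (U `|` V) f.
Proof. by move=> sU sV vs x [Ux|Vx]; [exact: sU|exact: sV]. Qed.

Lemma smooth_on_subset U V f : U `<=` V -> smooth_on V f -> smooth_on U f.
Proof. by move=> UV sV vs x /UV; exact: sV. Qed.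

Lemma smooth_on_continuous U f x : smooth_on U f -> U x -> {for x, continuous f}.
Proof.
move=> sf Ux; apply: differentiable_continuous; exact: smooth_on_differentiable sf Ux.
Qed.

End SmoothFunctions.

(** * Radial profiles and regularized powers *)

Section OneVariable.
Context {R : realType}.
Implicit Types (p c r a : R) (E : R -> R).

Definition radial_base E : (R -> R) -> Prop :=
  fun F => F = E \/ exists a, F = (fun r => r `^ a).

(** The Riccati equation writes [E'] as a polynomial in [E] and [r^(-1)], so all higher derivatives
    of [E] stay in the algebra. *)
Lemma radial_derive_closed E (b c : R) (I : set R) : (forall r, I r -> 0 < r) ->
  (forall r, I r -> is_derive r 1 E (- (E r / r) - b * E r ^+ 2 - c)) ->
  derive_closed I (radial_base E) (gen_alg (radial_base E)).
Proof.
move=> I0 dE F [->|[a ->]].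
  exists (fun r => ((-1) * (E r * r `^ (-1)) + (- b) * (E r * E r)) + (- c)); split.
    have gE : gen_alg (radial_base E) E by apply: gen_base; left.
    have gp : gen_alg (radial_base E) (fun r => r `^ (-1)).
      by apply: gen_base; right; exists (-1).
    by do ![apply: gen_add|apply: gen_mul|exact: gen_cst|done].
  move=> r Ir; apply: is_derive_eq (dE r Ir) _.
  by rewrite powR_inv1 ?ltW ?I0// mulN1r mulNr -expr2.
exists (fun r => a * r `^ (a - 1)); split.
  by apply: gen_mul; [exact: gen_cst|apply: gen_base; right; exists (a - 1)].
by move=> r Ir; exact: is_derive1_powR (I0 r Ir).
Qed.

(** For [del > 0] the base of the power stays positive on the whole line. The identity is a
    generator because the chain rule produces the factor [2 s]. *)
Definition regpow_base (del : R) : (R -> R) -> Prop :=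
  fun F => F = id \/ exists a, F = (fun s => (s ^+ 2 + del ^+ 2) `^ a).

Lemma is_derive_regpow (del a s : R) : 0 < del ->
  is_derive s 1 (fun s => (s ^+ 2 + del ^+ 2) `^ a)
    (a * (s ^+ 2 + del ^+ 2) `^ (a - 1) * (2 * s)).
Proof.
move=> d0; have y0 : 0 < s ^+ 2 + del ^+ 2 by rewrite ltr_wpDl ?sqr_ge0 ?exprn_gt0.
have dy : is_derive s 1 (fun s : R => s ^+ 2 + del ^+ 2) (2 * s).
  have -> : (fun s : R => s ^+ 2 + del ^+ 2) = (fun s => s * s + del ^+ 2).
    by apply/funext => t; rewrite expr2.
  by apply: is_derive_eq; rewrite /GRing.scale/=; ring.
have H := (@is_derive1_comp R (fun y => y `^ a) (fun s => s ^+ 2 + del ^+ 2) s _ _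
  (@is_derive1_powR _ a _ y0) dy).
exact: H.
Qed.

Lemma regpow_derive_closed (del : R) : 0 < del ->
  derive_closed setT (regpow_base del) (gen_alg (regpow_base del)).
Proof.
move=> d0 F [->|[a ->]].
  by exists (fun=> 1); split; [exact: gen_cst|move=> r _; exact: is_derive_id].
exists (fun s => (a * (s ^+ 2 + del ^+ 2) `^ (a - 1)) * (2 * s)); split; last first.
  by move=> s _; exact: is_derive_regpow.
apply: gen_mul; apply: gen_mul; try exact: gen_cst.
  by apply: gen_base; right; exists (a - 1).
by apply: gen_base; left.
Qed.

End OneVariable.

(** * The pointwise inequality *)



Section PowerInequalities.
Context {R : realType}.
Implicit Types (a b p x y : R).

Lemma powR_sqr x a : (x ^+ 2) `^ a = `|x| `^ (2 * a).
Proof.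
by rewrite -(ger0_norm (sqr_ge0 x)) normrX -powR_mulrn// -powRrM.
Qed.

Lemma normr_powR_split p b : 2 <= p -> `|b| `^ p = `|b| `^ (p - 2) * b ^+ 2.
Proof.
move=> p2; have -> : b ^+ 2 = `|b| `^ 2 by rewrite powR_mulrn// -normrX ger0_norm// sqr_ge0.
rewrite -powRD ?subrK//; apply/implyP => /eqP p0; lra.
Qed.

(** Young's inequality for [x^2] and [|b|^(p - 2)] with conjugate exponents [p / 2] and
    [p / (p - 2)]; the case [p = 2], where the second degenerates, is separate. *)
Lemma powR_young p x b : 2 <= p ->
  (1 - p / 2) * `|b| `^ p + p / 2 * (`|b| `^ (p - 2) * x ^+ 2) <= `|x| `^ p.
Proof.
rewrite le_eqVlt => /predU1P[<-|p2].
  rewrite subrr powRr0 divff ?subrr ?mul0r ?add0r ?mul1r//.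
  by rewrite powR_mulrn// -normrX ler_norm.
have p0 : 0 < p by lra.
have p20 : 0 < p - 2 by lra.
have := @conjugate_powR R (x ^+ 2) (`|b| `^ (p - 2)) (p / 2) (p / (p - 2)).
rewrite sqr_ge0 powR_ge0 !divr_gt0// => /(_ isT isT isT isT).
rewrite powR_sqr -powRrM mulrCA divff// mulr1 mulrCA divff ?gt_eqF// mulr1.
rewrite !invf_div => /(_ _).
have -> : 2 / p + (p - 2) / p = 1 by field; rewrite gt_eqF.
move=> /(_ erefl) H.
have -> : (1 - p / 2) = - (p / 2) * ((p - 2) / p) by field; rewrite gt_eqF.
have -> : `|x| `^ p = p / 2 * (`|x| `^ p * (2 / p)) by field; rewrite gt_eqF.
rewrite -mulrA mulNr addrC -mulrBr ler_pM2l ?divr_gt0//.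
by rewrite lerBlDr mulrC (mulrC ((p - 2) / p)).
Qed.

(* Bernoulli around [b = - kap * y], whose quadratic remainder is bounded below
   through [(x - b) ^ 2 >= 2 (x - b) (tau y) - (tau y) ^ 2]. *)
Lemma hardy_pointwise p kap x y tau : 2 <= p ->
  `|kap| `^ (p - 2) * (`|y| `^ (p - 2) *
    ((kap ^+ 2 - p * kap ^+ 2 + p * kap * tau - p / 2 * tau ^+ 2) * y ^+ 2
      + p * (tau - kap) * (y * x)))
  <= `|x| `^ p.
Proof.
move=> p2; apply: le_trans (powR_young x (- (kap * y)) p2).
rewrite (normr_powR_split (- (kap * y)) p2) normrN normrM powRM// [leLHS]mulrA.
set c := _ `^ _ * _ `^ _; have c0 : 0 <= c by rewrite mulr_ge0 ?powR_ge0.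
rewrite -subr_ge0 [leRHS](_ : _ = c * (p / 2 * (x + kap * y - tau * y) ^+ 2)).
  by apply: mulr_ge0 => //; apply: mulr_ge0; [lra|exact: sqr_ge0].
by field.
Qed.

(** This is [hardy_pointwise] at [x = r a], [y = u m], [tau = r E], multiplied by
    [r^(- p theta) m^alpha]. The [k^2] term of [G'] cancels the last term on the left. *)
Lemma weighted_hardy_pointwise p alpha theta Q k r m u a E :
  2 <= p -> 0 <= alpha -> 0 < r -> 0 <= m ->
  let kap := (Q - p * theta) / p in
  let G := r `^ (p * kap) * (r * E - kap) in
  let G' := r `^ (p * kap - 1) * (- (p * kap ^+ 2) + p * kap * (r * E)
     - p / 2 * (r * E) ^+ 2 - 2 / p * k ^+ 2 * r ^+ 2) in
  `|kap| `^ (p - 2) * (r `^ (1 - Q) * (m `^ (p + alpha - 2) *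
      (`|u| `^ p * G' * m ^+ 2 + G * (p * `|u| `^ (p - 2) * u) * (m * a))))
  + `|kap| `^ p * (`|u| `^ p / r `^ (p * theta) * m `^ (alpha + p))
  + 2 / p * `|kap| `^ (p - 2) * k ^+ 2 *
      (`|u| `^ p / r `^ (p * theta - 2) * m `^ (alpha + p))
  <= `|a| `^ p * m `^ alpha / r `^ (p * (theta - 1)).
Proof.
move=> p2 a0 r0 m0; cbv zeta; have p0 : p != 0 by rewrite gt_eqF//; lra.
have pk : p * ((Q - p * theta) / p) = Q - p * theta by field.
move: ((Q - p * theta) / p) pk => kap pk.
have rhs0 : 0 <= `|a| `^ p * m `^ alpha / r `^ (p * (theta - 1)).
  by rewrite !mulr_ge0 ?invr_ge0 ?powR_ge0.
(* At [m = 0] powers cannot be split by adding exponents; there the factors [m^2], [m a] and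
   [m^(alpha + p)] annihilate the left side. *)
have [m_0|mN0] := eqVneq m 0.
  have e0 : 0 `^ (alpha + p) = 0 :> R by rewrite powR0// gt_eqF//; lra.
  by rewrite m_0 in rhs0 *; rewrite e0 !mulr0 !addr0 mul0r mulr0 expr0n/= mulr0 addr0 !mulr0.
have {}m0 : 0 < m by rewrite lt_def mN0.
have rN : r != 0 by rewrite gt_eqF.
have rD s t : r `^ (s + t) = r `^ s * r `^ t by rewrite powRD// rN implybT.
have mD s t : m `^ (s + t) = m `^ s * m `^ t by rewrite powRD// mN0 implybT.
have r1 : r `^ 1 = r by rewrite powRr1// ltW.
have m1 : m `^ 1 = m by rewrite powRr1// ltW.
have r2 : r `^ 2 = r ^+ 2 by rewrite powR_mulrn// ltW.
have m2 : m `^ 2 = m ^+ 2 by rewrite powR_mulrn// ltW.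
have H := hardy_pointwise kap (r * a) (u * m) (r * E) p2.
have c0 : 0 <= r `^ (- (p * theta)) * m `^ alpha by rewrite mulr_ge0 ?powR_ge0.
have H' := ler_wpM2l c0 H.
rewrite !normrM (gtr0_norm r0) (gtr0_norm m0) in H'.
rewrite (powRM _ (ltW r0) (normr_ge0 a)) (powRM _ (normr_ge0 u) (ltW m0)) in H'.
have -> : `|a| `^ p * m `^ alpha / r `^ (p * (theta - 1)) =
    r `^ (- (p * theta)) * m `^ alpha * (r `^ p * `|a| `^ p).
  rewrite -powRN (_ : - (p * (theta - 1)) = - (p * theta) + p); last by ring.
  by rewrite rD; ring.
apply: le_trans H'.
rewrite -!powRN.
rewrite (_ : p * kap - 1 = - (p * theta) + (Q - 1)); last by rewrite pk; ring.
rewrite (_ : p * kap = - (p * theta) + ((Q - 1) + 1)); last by rewrite pk; ring.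
rewrite (_ : - (p * theta - 2) = - (p * theta) + 2); last by ring.
rewrite (_ : p + alpha - 2 = alpha + (p - 2)); last by ring.
rewrite (_ : alpha + p = alpha + ((p - 2) + 2)); last by ring.
rewrite (normr_powR_split u p2) (normr_powR_split kap p2).
(* Isolating [Q - 1] turns [r^(1 - Q)] into an inverse, after which both sides are equal as rational
   expressions. *)
have [q1 q1E] : exists q1, q1 = Q - 1 by exists (Q - 1).
have -> : r `^ (1 - Q) = (r `^ q1)^-1 by rewrite -powRN q1E opprB.
rewrite -q1E !(rD, mD) ?r1 ?r2 ?m2 ?m1.
have Q0 : r `^ q1 != 0 by rewrite gt_eqF// powR_gt0.
rewrite le_eqVlt; apply/orP; left; apply/eqP.
by field; rewrite ?Q0 ?p0.
Qed.
End PowerInequalities.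

(** * Continuity and gradients *)


Section Continuity.
Context {R : realType}.

Lemma continuous_powR_gt0 (r a : R) : 0 < r ->
  {for r, continuous (fun s : R => s `^ a)}.
Proof.
move=> r0; apply: differentiable_continuous; apply/derivable1_diffP.
by have [] := @is_derive1_powR R a r r0.
Qed.

(** The exponent 0 is included, by the convention that [0] to the power [0] is 1; it occurs as
    [p / 2 - 1] when [p = 2]. *)
Lemma continuous_normr_powR (a : R) : 0 <= a -> continuous (fun s : R => `|s| `^ a).
Proof.
rewrite le_eqVlt => /predU1P[<- s|a0 s].
  rewrite (_ : (fun s : R => `|s| `^ 0) = cst 1); first exact: cvg_cst.
  by apply/funext => t; rewrite powRr0.
have [->|s0] := eqVneq s 0; last first.
  apply: (@continuous_comp _ _ _ (fun s : R => `|s|) (fun s : R => s `^ a)).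
    exact: norm_continuous.
  by apply: continuous_powR_gt0; rewrite normr_gt0.
apply/cvgrPdist_lt => e e0; rewrite normr0 powR0 ?gt_eqF//.
apply/nbhs_normP; exists (e `^ a^-1); first by rewrite /= powR_gt0.
move=> t /=; rewrite !sub0r !normrN => te.
rewrite ger0_norm ?powR_ge0//.
have -> : e = (e `^ a^-1) `^ a by rewrite -powRrM mulVf ?gt_eqF// powRr1// ltW.
by apply: gt0_ltr_powR; rewrite // nnegrE ?powR_ge0.
Qed.

Lemma continuous_comp_powR (X : topologicalType) (f : X -> R) x (a : R) :
  0 <= a -> (forall y, 0 <= f y) -> {for x, continuous f} ->
  {for x, continuous (fun y => f y `^ a)}.
Proof.
move=> a0 f0 cf.
rewrite (_ : (fun y => f y `^ a) = (fun s : R => `|s| `^ a) \o f); last first.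
  by apply/funext => y /=; rewrite ger0_norm.
by apply: continuous_comp => //; exact: continuous_normr_powR.
Qed.

Lemma continuous_supported (X : topologicalType) (A B : set X) (f : X -> R) :
  (forall x, A x -> {for x, continuous f}) -> open B ->
  (forall x, B x -> f x = 0) -> (forall x, A x \/ B x) -> continuous f.
Proof.
move=> cA oB fB AB x; have [/cA//|Bx] := AB x.
have H : \near x, cst 0 x = f x.
  apply: (@filterS _ _ (nbhs_filter x) B); last exact: open_nbhs_nbhs.
  by move=> y By; rewrite fB.
by rewrite /continuous_at fB//; exact: cvg_trans (near_eq_cvg H) (cvg_cst 0).
Qed.

Lemma continuous_sum_at (X : topologicalType) n (f : 'I_n -> X -> R) x :
  (forall i, {for x, continuous (f i)}) ->
  {for x, continuous (fun y => \sum_(i < n) f i y)}.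
Proof.
move=> cf; have cadd : continuous (fun z : R * R => z.1 + z.2).
  by move=> z; exact: (cvgD (@cvg_fst _ _ _ _ _) (@cvg_snd _ _ _ _ _)).
exact: (@cvg_big R 'I_n +%R 0 xpredT cadd _ (nbhs x) (index_enum _) f
  (fun i => f i x) _ (fun i _ => cf i)).
Qed.

End Continuity.

Section Euclid.
Context {R : realType} {h : nat}.
Implicit Types (v w : 'I_h -> R).

Lemma edot_enorm v : edot v v = enorm v ^+ 2.
Proof.
rewrite /enorm sqr_sqrtr; last by apply: sumr_ge0 => i _; exact: sqr_ge0.
by apply: eq_bigr => i _; rewrite expr2.
Qed.

Lemma enorm_ge0 v : 0 <= enorm v. Proof. exact: sqrtr_ge0. Qed.

Lemma edotC v w : edot v w = edot w v.
Proof. by apply: eq_bigr => i _; rewrite mulrC. Qed.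

Lemma enorm_eq0 v i : enorm v = 0 -> v i = 0.
Proof.
move=> v0; have : edot v v = 0 by rewrite edot_enorm v0 expr0n.
move/eqP; rewrite psumr_eq0; last by move=> j _; rewrite -expr2 sqr_ge0.
by move=> /allP/(_ i (mem_index_enum _)); rewrite /= mulf_eq0 orbb => /eqP.
Qed.

Lemma enormZ (c : R) v : enorm (fun i => c * v i) = `|c| * enorm v.
Proof.
rewrite /enorm -sqrtr_sqr -sqrtrM ?sqr_ge0// mulr_sumr; congr Num.sqrt.
by apply: eq_bigr => i _; rewrite exprMn.
Qed.

Lemma edotZl (c : R) v w : edot (fun i => c * v i) w = c * edot v w.
Proof. by rewrite /edot mulr_sumr; apply: eq_bigr => i _; rewrite mulrA. Qed.

Lemma edotDr v w1 w2 : edot v (fun i => w1 i + w2 i) = edot v w1 + edot v w2.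
Proof. by rewrite /edot -big_split; apply: eq_bigr => i _; rewrite mulrDr. Qed.

Lemma edotZr (c : R) v w : edot v (fun i => c * w i) = c * edot v w.
Proof. by rewrite edotC edotZl edotC. Qed.

Lemma edot0r v w : (forall i, w i = 0) -> edot v w = 0.
Proof. by move=> w0; apply: big1 => i _; rewrite w0 mulr0. Qed.

Lemma enorm_mul_edot_unit v w : enorm w * edot v (fun i => w i / enorm w) = edot v w.
Proof.
have [w0|w0] := eqVneq (enorm w) 0.
  by rewrite w0 mul0r edot0r// => i; exact: enorm_eq0.
rewrite -edotZr; apply: eq_bigr => i _; congr (_ * _).
by rewrite mulrC divfK.
Qed.

(** Cauchy-Schwarz, from [|v - s n|^2 >= 0]. The bound [|n| <= 1] rather than equality covers
    [w = 0]. *)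
Lemma edot_unit_le v w : `|edot v (fun i => w i / enorm w)| <= enorm v.
Proof.
set n := fun i => _; set s := edot v n.
have n1 : edot n n <= 1.
  rewrite edot_enorm (_ : n = (fun i => (enorm w)^-1 * w i)); last first.
    by apply/funext => i; rewrite mulrC.
  rewrite enormZ ger0_norm ?invr_ge0 ?enorm_ge0//.
  have [->|w0] := eqVneq (enorm w) 0; first by rewrite mulr0 expr0n.
  by rewrite mulVf// expr1n.
have : 0 <= edot (fun i => v i + - s * n i) (fun i => v i + - s * n i).
  by apply: sumr_ge0 => i _; rewrite -expr2 sqr_ge0.
rewrite edotDr edotZr ![edot (fun i => _ + _) _]edotC !edotDr !edotZr.
rewrite (edotC n v) -/s edot_enorm => H.
rewrite -sqrtr_sqr -[leRHS]ger0_norm ?enorm_ge0// -[leRHS]sqrtr_sqr ler_wsqrtr//.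
have := ler_wpM2l (sqr_ge0 s) n1; rewrite mulr1 => H1.
by rewrite -subr_ge0; nra.
Qed.
End Euclid.

Section Gradient.
Context {R : realType} {N h : nat}.
Variable sigma : 'I_h -> 'I_N -> 'rV[R]_N -> R.
Notation pt := 'rV[R]_N.
Implicit Types (f g : pt -> R) (x : pt) (U : set pt).

Lemma gradL_eq0 U f x i : open U -> (forall y, U y -> f y = 0) -> U x ->
  gradL sigma f x i = 0.
Proof.
move=> oU f0 Ux; apply: big1 => j _; rewrite /pderiv.
rewrite (@near_eq_derive _ _ _ _ (cst 0)) ?derive_cst ?mulr0//.
exact: (open_near_eq (g := cst 0) oU f0 Ux).
Qed.

Lemma gradL_comp (F : R -> R) f x a i : differentiable f x ->
  is_derive (f x) 1 F a -> gradL sigma (F \o f) x i = a * gradL sigma f x i.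
Proof.
move=> df dF; rewrite /gradL /Xfield mulr_sumr; apply: eq_bigr => j _.
by rewrite /pderiv (derive_comp1 _ df dF) mulrCA.
Qed.

Lemma gradL_mul f g x i : differentiable f x -> differentiable g x ->
  gradL sigma (fun y => f y * g y) x i =
  f x * gradL sigma g x i + g x * gradL sigma f x i.
Proof.
move=> df dg; rewrite /gradL /Xfield !mulr_sumr -big_split/=.
apply: eq_bigr => j _; rewrite /pderiv -[X in _ * X]/('D_(@evec R N j) (f * g) x).
rewrite deriveM; [|exact: diff_derivable|exact: diff_derivable].
by rewrite /GRing.scale/= mulrDr !mulrA ![sigma i j x * _]mulrC.
Qed.

End Gradient.

(** * The divergence free field *)


Section DivergenceFree.
Context {R : realType} {N h : nat}.
Variables (sigma : 'I_h -> 'I_N -> 'rV[R]_N -> R) (d : 'rV[R]_N -> R).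
Variable (Q : R).
Notation pt := 'rV[R]_N.
Notation gd := (gradL sigma d).
Hypothesis sd : smooth_on (~` [set 0]) d.
Hypothesis d0 : forall x, d x = 0 <-> x = 0.
Hypothesis d_ge0 : forall x, 0 <= d x.
Hypothesis harmonic : forall q : R, 2 <= q ->
     (q != Q -> Lp_harmonic sigma q (~` [set 0]) (fun x => d x `^ ((q - Q) / (q - 1)))) /\
     (q = Q -> Lp_harmonic sigma q (~` [set 0]) (fun x => - ln (d x))).

Lemma d_gt0 x : x != 0 -> 0 < d x.
Proof. by move=> x0; rewrite lt_def d_ge0 andbT; apply: contra_neq x0 => /d0. Qed.

(* Both fundamental solutions [v] give |grad v| ^ (q - 2) grad v =
   C d ^ (1 - Q) |grad d| ^ (q - 2) grad d. *)
Lemma radial_harmonic q : 2 <= q -> exists (C : R) (v : pt -> R) (F' : R -> R),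
  [/\ C != 0, Lp_harmonic sigma q (~` [set 0]) v,
      forall x, x != 0 -> forall i, gradL sigma v x i = F' (d x) * gd x i
    & forall r, 0 < r -> `|F' r| `^ (q - 2) * F' r = C * r `^ (1 - Q)].
Proof.
move=> q2; have [hq hQ] := harmonic q2.
have dd x : x != 0 -> differentiable d x.
  by move=> x0; apply: smooth_on_differentiable sd _; exact/eqP.
have [qQ|qQ] := eqVneq q Q.
  exists (-1), (fun x => - ln (d x)), (fun r => - r^-1); split.
  - by rewrite oppr_eq0 oner_eq0.
  - exact: hQ.
  - move=> x x0 i; apply: (@gradL_comp _ _ _ sigma (fun r => - ln r) d x _ i); first exact: dd.
    by apply: is_deriveN; exact: is_derive1_ln (d_gt0 x0).
  - move=> r r0; rewrite normrN gtr0_norm ?invr_gt0// mulN1r mulrN; congr (- _).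
    rewrite -powR_inv1 ?ltW// -powRrM -powRD; last by rewrite (gt_eqF r0) implybT.
    by congr (_ `^ _); rewrite qQ; ring.
(* This exponent satisfies [(ga - 1) (q - 1) = 1 - Q], so the power of [d] in the field is the same
   for every [q]. *)
pose ga := (q - Q) / (q - 1); have q1 : q - 1 != 0 by rewrite gt_eqF//; lra.
have ga0 : ga != 0 by rewrite mulf_neq0 ?invr_eq0// subr_eq0.
exists (`|ga| `^ (q - 2) * ga), (fun x => d x `^ ga), (fun r => ga * r `^ (ga - 1)); split.
- by rewrite mulf_neq0// gt_eqF// powR_gt0 ?normr_gt0.
- exact: hq.
- move=> x x0 i; apply: (@gradL_comp _ _ _ sigma (fun r => r `^ ga) d x _ i); first exact: dd.
  exact: is_derive1_powR (d_gt0 x0).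
- move=> r r0; rewrite normrM (ger0_norm (powR_ge0 _ _)) powRM ?powR_ge0//.
  rewrite mulrACA -powRrM -powRD; last by rewrite (gt_eqF r0) implybT.
  by congr (_ * _); congr (_ `^ _); rewrite /ga; field.
Qed.

(** The constant stays under the integral; it is extracted later, once the integrand is known to be
    continuous with compact support. *)
Lemma weighted_divergence_free q : 2 <= q -> exists2 C : R, C != 0 &
  forall phi, Cc_infty (~` [set 0]) phi ->
    integralRN (fun x => (C * (d x `^ (1 - Q) * (enorm (gd x) `^ (q - 2) *
      edot (gd x) (gradL sigma phi x))))%:E) = 0%E.
Proof.
move=> q2; have [C [v [F' [C0 hv gv FE]]]] := radial_harmonic q2.
exists C => // phi Cphi; have := hv _ Cphi; rewrite /integral_on => <-.
congr integralRN; apply/funext => x; rewrite asboolT//; congr EFin.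
have [x0|x0] := eqVneq x 0; last first.
  have -> : gradL sigma v x = (fun i => F' (d x) * gd x i) by apply/funext => i; exact: gv.
  rewrite enormZ powRM ?enorm_ge0// edotZl [RHS]mulrACA FE ?d_gt0//.
  by rewrite !mulrA.
(* At the origin [d] may fail to be differentiable, but [phi] vanishes nearby and both integrands
   are 0. *)
have [_ [K [cK KU phiK]]] := Cphi.
have gphi0 i : gradL sigma phi x i = 0.
  apply: (@gradL_eq0 _ _ _ _ (~` K) phi); last by move=> /KU/= /(_ x0).
    by apply: closed_openC; apply: compact_closed cK; exact: norm_hausdorff.
  exact: phiK.
have e1 := edot0r (gradL sigma v x) gphi0.
have e2 := edot0r (gd x) gphi0.
have mul0 (a b c : R) : C * (a * (b * 0)) = c * 0 by rewrite !mulr0.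
by rewrite e1 e2; exact: mul0.
Qed.

End DivergenceFree.

(** * The weighted Hardy inequality *)


Lemma continuous_sqr_at (R : realType) (X : topologicalType) (f : X -> R) x :
  {for x, continuous f} -> {for x, continuous (fun y => f y ^+ 2)}.
Proof. by move=> cf; exact: (continuousM cf cf). Qed.

Lemma continuous_comp_snd (R : realType) (X Y : topologicalType) (f : Y -> R)
  (z : X * Y) :
  {for z.2, continuous f} -> {for z, continuous (fun z : X * Y => f z.2)}.
Proof.
move=> cf; apply: (@continuous_comp (X * Y)%type Y R snd f z); last exact: cf.
exact: cvg_snd.
Qed.

Lemma continuous_slice (R : realType) (X Y : topologicalType) (f : X * Y -> R)
  (a : X) : continuous f -> continuous (fun y => f (a, y)).
Proof.
move=> cf y; apply: (@continuous_comp Y (X * Y)%type R (fun y => (a, y)) f y); last exact: cf.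
exact: (cvg_pair (cvg_cst _) (@cvg_id _ _)).
Qed.

Section GradientContinuity.
Context {R : realType} {N h : nat}.
Variable sigma : 'I_h -> 'I_N -> 'rV[R]_N -> R.
Notation pt := 'rV[R]_N.
Hypothesis csigma : forall i j, continuous (sigma i j).

Lemma continuous_gradL (U : set pt) f x i : smooth_on U f -> U x ->
  {for x, continuous (fun y => gradL sigma f y i)}.
Proof.
move=> sf Ux; apply: continuous_sum_at => j; apply: continuousM; first exact: csigma.
exact: smooth_on_continuous (smooth_on_derive _ sf) Ux.
Qed.

Lemma continuous_edot_at (f g : pt -> 'I_h -> R) x :
  (forall i, {for x, continuous (fun y => f y i)}) ->
  (forall i, {for x, continuous (fun y => g y i)}) ->
  {for x, continuous (fun y => edot (f y) (g y))}.
Proof. by move=> cf cg; apply: continuous_sum_at => i; exact: continuousM. Qed.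

Lemma continuous_enorm_at (f : pt -> 'I_h -> R) x :
  (forall i, {for x, continuous (fun y => f y i)}) ->
  {for x, continuous (fun y => enorm (f y))}.
Proof.
move=> cf; rewrite (_ : (fun y => enorm (f y)) = Num.sqrt \o (fun y => edot (f y) (f y))).
  by apply: continuous_comp; [exact: continuous_edot_at|exact: sqrt_continuous].
by apply/funext => y /=; rewrite edot_enorm sqrtr_sqr ger0_norm// enorm_ge0.
Qed.
End GradientContinuity.

Section WeightedHardy.
Context {R : realType} {N h : nat}.
Variables (sigma : 'I_h -> 'I_N -> 'rV[R]_N -> R) (d : 'rV[R]_N -> R).
Variables (Q p alpha theta k Rp : R) (E : R -> R).
Notation pt := 'rV[R]_N.
Variables (u : pt -> R) (K : set pt).
Notation gd := (gradL sigma d).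
Notation gu := (gradL sigma u).
Hypothesis csigma : forall i j, continuous (sigma i j).
Hypothesis cd : continuous d.
Hypothesis sd : smooth_on (~` [set 0]) d.
Hypothesis d0 : forall x, d x = 0 <-> x = 0.
Hypothesis d_ge0 : forall x, 0 <= d x.
Hypothesis harmonic : forall q : R, 2 <= q ->
     (q != Q -> Lp_harmonic sigma q (~` [set 0]) (fun x => d x `^ ((q - Q) / (q - 1)))) /\
     (q = Q -> Lp_harmonic sigma q (~` [set 0]) (fun x => - ln (d x))).
Hypotheses (p2 : 2 <= p) (alpha0 : 0 <= alpha).
Hypothesis su : smooth_on setT u.
Hypothesis cK : compact K.
Hypothesis Kd : forall x, K x -> 0 < d x < Rp.
Hypothesis uK : forall x, ~ K x -> u x = 0.
Hypothesis dE : forall r, 0 < r < Rp ->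
  is_derive r 1 E (- (E r / r) - p / 2 * E r ^+ 2 - 2 / p * k ^+ 2).

Let kap := (Q - p * theta) / p.
Let G r := r `^ (p * kap) * (r * E r - kap).
Let G' r := r `^ (p * kap - 1) * (- (p * kap ^+ 2) + p * kap * (r * E r)
     - p / 2 * (r * E r) ^+ 2 - 2 / p * k ^+ 2 * r ^+ 2).
Let H (del s : R) := (s ^+ 2 + del ^+ 2) `^ (p / 2) - (del ^+ 2) `^ (p / 2).
Let H' (del s : R) := p * (s ^+ 2 + del ^+ 2) `^ (p / 2 - 1) * s.
Let U : set pt := [set x | 0 < d x < Rp].
(** The divergence form tested with [G(d) H(u)], expanded by the product rule as a function of
    [(del, x)]. The expanded form still makes sense at [del = 0]. *)
Let W (z : R * pt) := d z.2 `^ (1 - Q) * (enorm (gd z.2) `^ (p + alpha - 2) *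
  (H z.1 (u z.2) * G' (d z.2) * enorm (gd z.2) ^+ 2
    + G (d z.2) * H' z.1 (u z.2) * edot (gd z.2) (gu z.2))).

Let p0 : p != 0. Proof. by apply: lt0r_neq0; exact: lt_le_trans p2. Qed.

Let half_p : 0 <= p / 2. Proof. by move: p2; lra. Qed.

Let half_p1 : 0 <= p / 2 - 1. Proof. by move: p2; lra. Qed.

Let palpha : 0 <= p + alpha - 2. Proof. by move: p2 alpha0; lra. Qed.

Let closedK : closed K.
Proof. by apply: compact_closed cK; exact: norm_hausdorff. Qed.

Let openU : open U.
Proof.
rewrite (_ : U = d @^-1` `]0, Rp[); last by apply/seteqP; split => x; rewrite /U/= in_itv.
by apply: open_comp; [move=> x _; exact: cd|exact: interval_open].
Qed.

Let U_neq0 x : U x -> x != 0.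
Proof. by move=> /andP[dx _]; apply: contraTneq dx => /d0 ->; rewrite ltxx. Qed.

(** In [(r E)' = E + r E'] the Riccati term [- E / r] cancels [E], leaving
    [- (p / 2) r E^2 - (2 / p) k^2 r]. *)
Let is_derive_G (r : R) : 0 < r < Rp -> is_derive r 1 G (G' r).
Proof.
move=> rI; have /andP[r0 _] := rI.
have dEr := dE rI; have dp := @is_derive1_powR R (p * kap) r r0.
have drE : is_derive r 1 (fun r => r * E r - kap) (r * (- (E r / r) - p / 2 * E r ^+ 2 - 2 / p * k ^+ 2) + E r).
  by apply: is_derive_eq; rewrite /GRing.scale/=; ring.
apply: (is_derive_eq (is_deriveM dp drE)); rewrite /GRing.scale/= /G'.
have -> : r `^ (p * kap) = r `^ (p * kap - 1) * r.
  by rewrite -[X in _ = _ * X](powRr1 (ltW r0)) -powRD ?subrK// (gt_eqF r0) implybT.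
by field; rewrite p0 (gt_eqF r0).
Qed.

Let is_derive_H (del s : R) : 0 < del -> is_derive s 1 (H del) (H' del s).
Proof.
move=> del0; have := @is_derive_regpow R del (p / 2) s del0 => dp.
by apply: is_derive_eq; rewrite /H' ; field.
Qed.

Let phi (del : R) : pt -> R := fun x => G (d x) * H del (u x).

Let H0 del : H del 0 = 0.
Proof. by rewrite /H expr0n add0r subrr. Qed.

Let H'0 del : H' del 0 = 0. Proof. by rewrite /H' mulr0. Qed.

Let smooth_Gd : smooth_on U (G \o d).
Proof.
(* Writing [r] as a power with exponent 1 puts the profile in the algebra of [radial_base]; the two
   agree at [d x] since [d] is nonnegative. *)
pose G0 r := r `^ (p * kap) * (r `^ 1 * E r + - kap).
have sG0 : smooth_on U (G0 \o d).
  apply: (@smooth_on_comp _ _ U [set r | 0 < r < Rp] (gen_alg (radial_base E))) => //.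
  - apply: gen_alg_derive_closed; apply: (@radial_derive_closed _ E (p / 2) (2 / p * k ^+ 2)).
    by move=> r /andP[].
  - have gE : gen_alg (radial_base E) E by apply: gen_base; left.
    have gp a : gen_alg (radial_base E) (fun r => r `^ a).
      by apply: gen_base; right; exists a.
    apply: gen_mul; first exact: gp.
    apply: gen_add; last exact: gen_cst.
    by apply: gen_mul; first exact: gp.
  - by apply: smooth_on_subset sd => x /U_neq0/eqP.
apply: smooth_on_eq sG0 => // x _; rewrite /= /G0 /G powRr1//.
Qed.

Let smooth_Hu (del : R) : 0 < del -> smooth_on setT (H del \o u).
Proof.
move=> del0; apply: (@smooth_on_comp _ _ setT setT (gen_alg (regpow_base del))) => //.
- exact: openT.
- exact/gen_alg_derive_closed/regpow_derive_closed.
- apply: gen_add; last exact: gen_cst.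
  by apply: gen_base; right; exists (p / 2).
Qed.

(** The open sets [U] and the complement of [K] cover the space; on the latter [H del 0 = 0] makes
    the product vanish, whatever [G] does there. *)
Let test_phi (del : R) : 0 < del -> Cc_infty (~` [set 0]) (phi del).
Proof.
move=> del0; split; last first.
  exists K; split => // [x /Kd /U_neq0/eqP//|x /uK ux].
  by rewrite /phi ux H0 mulr0.
apply: (@smooth_on_subset _ _ _ (U `|` ~` K)).
  by move=> x _; have [/Kd|] := pselect (K x); [left|right].
apply: smooth_on_setU.
  apply: smooth_on_mul => //; apply: smooth_on_subset (smooth_Hu del0); exact: subsetT.
apply: (@smooth_on_eq _ _ (~` K) (fun=> 0)); last exact: smooth_on_cst0.
  exact: closed_openC.
by move=> x /uK ux; rewrite /phi ux H0 mulr0.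
Qed.

Let W0 z : ~ K z.2 -> W z = 0.
Proof. by move=> /uK uz; rewrite /W uz H0 H'0 mul0r mul0r mulr0 mul0r addr0 !mulr0. Qed.

Let edot_phi del x : 0 < del ->
  d x `^ (1 - Q) * (enorm (gd x) `^ (p + alpha - 2) *
    edot (gd x) (gradL sigma (phi del) x)) = W (del, x).
Proof.
move=> del0; have [Kx|Kx] := pselect (K x); last first.
  rewrite W0//; have := @gradL_eq0 _ _ _ sigma (~` K) (phi del) x.
  move=> g0; rewrite (@edot0r _ _ (gd x)) ?mulr0// => i; apply: g0 => //.
    exact: closed_openC.
  by move=> y /uK uy; rewrite /phi uy H0 mulr0.
have Ux := Kd Kx; rewrite /W/=; congr (_ * (_ * _)).
have dd : differentiable d x by apply: smooth_on_differentiable sd _; exact/eqP/U_neq0.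
have du : differentiable u x by exact: smooth_on_differentiable su _.
have dGd : differentiable (G \o d) x by exact: smooth_on_differentiable smooth_Gd _.
have dHu : differentiable (H del \o u) x by exact: smooth_on_differentiable (smooth_Hu del0) _.
have -> : gradL sigma (phi del) x =
    (fun i => G (d x) * H' del (u x) * gu x i + H del (u x) * G' (d x) * gd x i).
  apply/funext => i; rewrite (@gradL_mul _ _ _ sigma (G \o d) (H del \o u))//.
  rewrite (gradL_comp sigma i dd (is_derive_G Ux)).
  by rewrite (gradL_comp sigma i du (is_derive_H (u x) del0)) /= !mulrA.
by rewrite edotDr !edotZr edot_enorm addrC.
Qed.

Let cgd x i : U x -> {for x, continuous (fun y => gd y i)}.
Proof. by move=> Ux; apply: continuous_gradL sd _ => //; exact/eqP/U_neq0. Qed.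

Let cgu x i : {for x, continuous (fun y => gu y i)}.
Proof. exact: continuous_gradL su _. Qed.

Let cm x : U x -> {for x, continuous (fun y => enorm (gd y))}.
Proof. by move=> Ux; apply: continuous_enorm_at => i; exact: cgd. Qed.

Let cdpow a x : U x -> {for x, continuous (fun y => d y `^ a)}.
Proof.
move=> /andP[dx _]; apply: (@continuous_comp _ _ _ d (fun r : R => r `^ a)); first exact: cd.
exact: continuous_powR_gt0.
Qed.

Let cE x : U x -> {for x, continuous (E \o d)}.
Proof.
move=> Ux; apply: continuous_comp; first exact: cd.
apply: differentiable_continuous; apply/derivable1_diffP.
by have [] := dE Ux.
Qed.

Let ccst (X : topologicalType) (x : X) (c : R) : {for x, continuous (fun _ : X => c)}.
Proof. exact: cvg_cst. Qed.

Let cdE x : U x -> {for x, continuous (fun y => d y * E (d y))}.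
Proof. by move=> Ux; exact: (continuousM (@cd x) (cE Ux)). Qed.

Let cG x : U x -> {for x, continuous (fun y => G (d y))}.
Proof.
move=> Ux; rewrite /G; apply: continuousM; first exact: cdpow.
by apply: continuousB; [exact: cdE|exact: ccst].
Qed.

Let cG' x : U x -> {for x, continuous (fun y => G' (d y))}.
Proof.
move=> Ux; rewrite /G'; apply: continuousM; first exact: cdpow.
apply: continuousB.
  apply: continuousB.
    by apply: continuousD; [exact: ccst|apply: continuousM; [exact: ccst|exact: cdE]].
  by apply: continuousM; [exact: ccst|apply: continuous_sqr_at; exact: cdE].
by apply: continuousM; [exact: ccst|apply: continuous_sqr_at; exact: cd].
Qed.

(** Joint continuity reaches [del = 0] because the exponents [p / 2], [p / 2 - 1] and
    [p + alpha - 2] are nonnegative. *)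
Let continuous_W : continuous W.
Proof.
apply: (@continuous_supported _ _ [set z | U z.2] [set z | (~` K) z.2]) => [z Uz||z|z].
- have {}Uz : U z.2 := Uz.
  have csnd (f : pt -> R) := @continuous_comp_snd R R pt f z.
  have cb : {for z, continuous (fun z : R * pt => u z.2 ^+ 2 + z.1 ^+ 2)}.
    apply: continuousD; apply: continuous_sqr_at; last exact: cvg_fst.
    by apply: csnd; exact: smooth_on_continuous su _.
  have cb1 : {for z, continuous (fun z : R * pt => z.1 ^+ 2)}.
    by apply: continuous_sqr_at; exact: cvg_fst.
  have cu : {for z, continuous (fun z : R * pt => u z.2)}.
    by apply: csnd; exact: smooth_on_continuous su _.
  have cH : {for z, continuous (fun z : R * pt => H z.1 (u z.2))}.
    apply: continuousB; apply: continuous_comp_powR => //; try (by move=> y; rewrite ?addr_ge0 ?sqr_ge0).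
  have cH' : {for z, continuous (fun z : R * pt => H' z.1 (u z.2))}.
    apply: continuousM => //; apply: continuousM; first exact: ccst.
    by apply: continuous_comp_powR => // y; rewrite addr_ge0 ?sqr_ge0.
  apply: continuousM; first by apply: (csnd (fun y => d y `^ (1 - Q))); exact: cdpow.
  apply: continuousM.
    apply: (csnd (fun y => enorm (gd y) `^ _)); apply: continuous_comp_powR.
    + exact: palpha.
    + by move=> y; exact: enorm_ge0.
    + exact: cm.
  apply: continuousD.
    apply: continuousM.
      by apply: continuousM => //; apply: (csnd (fun y => G' (d y))); exact: cG'.
    apply: (csnd (fun y => enorm (gd y) ^+ 2)).
    by apply: continuous_sqr_at; exact: cm.
  apply: continuousM.
    by apply: continuousM => //; apply: (csnd (fun y => G (d y))); exact: cG.
  apply: (csnd (fun y => edot (gd y) (gu y))).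
  by apply: continuous_edot_at => i; [exact: cgd|exact: cgu].
- apply: (@open_comp _ _ snd (~` K)); last exact: closed_openC.
  by move=> z _; exact: cvg_snd.
- exact: W0.
- by have [/Kd|] := pselect (K z.2); [left|right].
Qed.

(* [W (del, .)] is the weak divergence form tested with the smooth function
   [phi del] for [del > 0]; the case [del = 0], where [H 0 s = |s| ^ p] need not
   be smooth, follows by continuity of the integral in [del]. *)
Let integral_W0 : integralRN (fun x => (W (0, x))%:E) = 0%E.
Proof.
have q2 : 2 <= p + alpha by move: p2 alpha0; lra.
have [C C0 hC] := weighted_divergence_free sd d0 d_ge0 harmonic q2.
have [g [cg gE]] := continuous_parameter_integral cK continuous_W W0.
have WK x : ~ K x -> W (0, x) = 0 by exact: (@W0 (0, x)).
have CW (del : R) : 0 < del -> C * g del = 0.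
  move=> del0; have := hC _ (test_phi del0).
  under eq_fun do rewrite edot_phi//.
  have cWd := continuous_slice (a := del) continuous_W.
  have WdK x : ~ K x -> W (del, x) = 0 by exact: (@W0 (del, x)).
  (* Linearity with second coefficient 0 serves to take [C] out of the integral. *)
  have [I1 [I2 [e1 e2]]] := integralRN_linear cK C 0 cWd cWd WdK WdK.
  under [X in integralRN X]eq_fun do rewrite mul0r addr0.
  move=> -> /eqP; rewrite mul0r addr0 eqe => /eqP CI.
  by move: e1; rewrite /comp gE => -[->].
have g0 (del : R) : 0 < del -> g del = 0.
  by move=> /CW/eqP; rewrite mulf_eq0 (negbTE C0) => /eqP.
(* A nonzero value of [g] at 0 would contradict continuity, as seen at [e / 2], where [g]
   vanishes. *)
rewrite gE; congr EFin; apply/eqP; apply: contraT => g00.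
have /cvgrPdist_lt/(_ `|g 0|) := cg 0; rewrite normr_gt0 g00 => /(_ isT).
move=> /nbhs_ballP[e e0 /(_ (e / 2))]; rewrite /ball/= sub0r normrN.
rewrite gtr0_norm ?divr_gt0//; have e2 : e / 2 < e by move: e0 => /=; lra.
by move=> /(_ e2) /=; rewrite (g0 (e / 2)) ?divr_gt0// subr0 ltxx.
Qed.

Let B a x := `|u x| `^ p / d x `^ a * enorm (gd x) `^ (alpha + p).

Let normu_powR x : ~ K x -> `|u x| `^ p = 0.
Proof. by move=> /uK ->; rewrite normr0 powR0. Qed.

Let BK a x : ~ K x -> B a x = 0.
Proof. by move=> Kx; rewrite /B normu_powR// !mul0r. Qed.

Let continuous_B a : continuous (B a).
Proof.
apply: (@continuous_supported _ _ U (~` K)) => [x Ux||x|x].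
- have ap : 0 <= alpha + p by move: p2 alpha0; lra.
  have pp : 0 <= p by move: p2; lra.
  apply: continuousM; last by apply: continuous_comp_powR => //; [move=> y; exact: enorm_ge0|exact: cm].
  rewrite (_ : (fun y => _) = (fun y => `|u y| `^ p * d y `^ (- a))).
    apply: continuousM; last exact: cdpow.
    apply: (@continuous_comp _ _ _ u (fun s : R => `|s| `^ p)).
      exact: smooth_on_continuous su _.
    exact: continuous_normr_powR.
  by apply/funext => y; rewrite powRN.
- exact: closed_openC.
- exact: BK.
- by have [/Kd|] := pselect (K x); [left|right].
Qed.

Lemma integral_weight_finite a : exists I : R,
  integralRN (fun x => (`|u x| `^ p / d x `^ a * enorm (gd x) `^ (alpha + p))%:E) = I%:E.
Proof.
have [I [_ [IE _ _]]] := integralRN_linear cK 0 0 (@continuous_B (a)) (@continuous_B (a))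
  (@BK (a)) (@BK (a)).
by exists I; rewrite -IE.
Qed.

Let P x := `|edot (gu x) (fun i => gd x i / enorm (gd x))| `^ p
        * enorm (gd x) `^ alpha / d x `^ (p * (theta - 1)).

(** The grouping and the coefficient 1 match two successive uses of [integralRN_linear]. *)
Let pointwise x :
  1 * (`|kap| `^ (p - 2) * W (0, x) + `|kap| `^ p * B (p * theta) x) +
  2 / p * `|kap| `^ (p - 2) * k ^+ 2 * B (p * theta - 2) x <= P x.
Proof.
have [Kx|Kx] := pselect (K x); last first.
  rewrite !BK// (@W0 (0, x))// !mulr0 !addr0 mulr0.
  by rewrite /P !mulr_ge0 ?invr_ge0 ?powR_ge0.
have /andP[dx _] := Kd Kx; rewrite mul1r /P.
set a := edot (gu x) _.
have ma : edot (gd x) (gu x) = enorm (gd x) * a.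
  by rewrite edotC -enorm_mul_edot_unit.
have HE : H 0 (u x) = `|u x| `^ p.
  rewrite /H expr0n addr0 powR_sqr powR0 ?subr0; last by rewrite mulf_neq0 ?invr_eq0.
  by congr (_ `^ _); field.
have H'E : H' 0 (u x) = p * `|u x| `^ (p - 2) * u x.
  rewrite /H' expr0n addr0 powR_sqr; congr (_ * _ `^ _ * _); by field.
have := @weighted_hardy_pointwise R p alpha theta Q k (d x) (enorm (gd x)) (u x) a (E (d x))
  p2 alpha0 dx (enorm_ge0 _).
by rewrite /W/= HE H'E ma.
Qed.

(** Integrates [pointwise]: the [W] term contributes 0, and [P] is handled by monotonicity alone. *)
Lemma weighted_hardy (I1 I2 : R) :
  integralRN (fun x => (`|u x| `^ p / d x `^ (p * theta) * enorm (gd x) `^ (alpha + p))%:E) = I1%:E ->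
  integralRN (fun x => (`|u x| `^ p / d x `^ (p * theta - 2) * enorm (gd x) `^ (alpha + p))%:E) = I2%:E ->
  ((`|kap| `^ p * I1 + 2 / p * `|kap| `^ (p - 2) * k ^+ 2 * I2)%:E <=
   integralRN (fun x => (P x)%:E))%E.
Proof.
move=> I1E I2E.
have cW0 := continuous_slice (a := 0) continuous_W.
have WK x : ~ K x -> W (0, x) = 0 by exact: (@W0 (0, x)).
have [J0 [J1 [J0E J1E J01E]]] := integralRN_linear cK (`|kap| `^ (p - 2)) (`|kap| `^ p)
  cW0 (@continuous_B (p * theta)) WK (@BK (p * theta)).
pose f x := `|kap| `^ (p - 2) * W (0, x) + `|kap| `^ p * B (p * theta) x.
have cf : continuous f.
  by move=> x; exact: (cvgD (cvgMl_tmp (cW0 x)) (cvgMl_tmp (@continuous_B _ x))).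
have fK x : ~ K x -> f x = 0 by move=> Kx; rewrite /f WK// BK// !mulr0 addr0.
have [Jf [J2 [JfE J2E JE]]] := integralRN_linear cK 1 (2 / p * `|kap| `^ (p - 2) * k ^+ 2)
  cf (@continuous_B (p * theta - 2)) fK (@BK (p * theta - 2)).
have [j0] : J0%:E = 0%E by rewrite -J0E; exact: integral_W0.
have [j1] : J1%:E = I1%:E by rewrite -J1E -I1E.
have [j2] : J2%:E = I2%:E by rewrite -J2E -I2E.
have [jf] : Jf%:E = (`|kap| `^ (p - 2) * J0 + `|kap| `^ p * J1)%:E by rewrite -JfE -J01E.
rewrite (_ : `|kap| `^ p * I1 + _ = 1 * Jf + 2 / p * `|kap| `^ (p - 2) * k ^+ 2 * J2); last first.
  by rewrite jf j0 j1 j2; ring.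
by rewrite -JE; apply: le_iint => x; rewrite lee_fin; exact: pointwise.
Qed.
End WeightedHardy.


(** * Integrals over the ball, the limit in [k], and the conclusion *)

Lemma integral_onE (R : realType) (N : nat) (D : set 'rV[R]_N) (f : 'rV[R]_N -> R) :
  (forall x, ~ D x -> f x = 0) ->
  integral_on D f = integralRN (fun x => (f x)%:E).
Proof.
move=> f0; congr integralRN; apply/funext => x.
by case: asboolP => // Dx; rewrite f0.
Qed.

Lemma le_integral_on (R : realType) (N : nat) (D : set 'rV[R]_N)
  (f g : 'rV[R]_N -> R) :
  (forall x, f x <= g x) -> (integral_on D f <= integral_on D g)%E.
Proof. by move=> fg; apply: le_iint => x; case: ifP => // _; rewrite lee_fin. Qed.

(** Continuity in [k], made explicit by evaluating at [k0 (1 - s)]; [D] may have either sign. *)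
Lemma le_ereal_quadratic_lim (R : realType) (A D k0 : R) (y : \bar R) : 0 < k0 ->
  (forall k, 0 < k < k0 -> ((A + D * k ^+ 2)%:E <= y)%E) ->
  ((A + D * k0 ^+ 2)%:E <= y)%E.
Proof.
move=> k00; case: y => [r| |] hy.
- rewrite lee_fin; apply/ler_addgt0Pr => e e0.
  pose D' := `|D| * k0 ^+ 2; have D'0 : 0 <= D' by rewrite mulr_ge0 ?sqr_ge0.
  (* This choice gives [s < 1] and bounds the loss [s (2 - s) D'] by [2 s (D' + e) = e], even when
     [D = 0]. *)
  pose s := e / (2 * (D' + e)); have De : 0 < 2 * (D' + e) by lra.
  have s0 : 0 < s by rewrite divr_gt0.
  have sE : s * (2 * (D' + e)) = e by rewrite divfK// gt_eqF.
  have s1 : s < 1 by rewrite ltr_pdivrMr//; lra.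
  have := hy (k0 * (1 - s)); rewrite mulr_gt0 ?subr_gt0//= gtr_pMr// => hk.
  have {hk} := hk _; rewrite ltrBlDr ltrDl s0 => /(_ isT); rewrite lee_fin => hk.
  have DD : D * k0 ^+ 2 <= D' by rewrite ler_wpM2r ?sqr_ge0// ler_norm.
  rewrite (le_trans (y := A + D * (k0 * (1 - s)) ^+ 2 + e))//; last by rewrite lerD2r.
  rewrite exprMn mulrA -addrA lerD2l -subr_ge0.
  rewrite [leRHS](_ : _ =
    s * (2 - s) * (D' - D * k0 ^+ 2) + (e - s * (2 - s) * D')); last by ring.
  apply: addr_ge0; first by apply: mulr_ge0; [apply: mulr_ge0; lra|rewrite subr_ge0].
  by rewrite subr_ge0 -[leRHS]sE; nra.
- exact: leey.
(* One admissible [k] already excludes the value minus infinity. *)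
- have h2 : 0 < k0 / 2 < k0 by lra.
  by have := hy _ h2.
Qed.

Unset Implicit Arguments.
Set Strict Implicit.

Theorem mainTheorem5 (R : realType) (N h : nat)
  (sigma : 'I_h -> 'I_N -> 'rV[R]_N -> R)
  (beta : 'I_N -> R) (d : 'rV[R]_N -> R)
  (p alpha theta Rad z0 : R) :
  (* vector fields X_i = sum_j sigma_ij d_j, with sigma_ij, d_j sigma_ij continuous *)
  (h <= N)%N ->
  (forall i j, continuous (sigma i j)) ->
  (forall i j (x : 'rV[R]_N), derivable (sigma i j) x (@evec R N j)) ->
  (forall i j, continuous (pderiv j (sigma i j))) ->
  (* dilations, each X_i homogeneous of degree one *)
  (forall j, 0 < beta j) ->
  (forall i (lam : R) (f : 'rV[R]_N -> R), 0 < lam -> smooth_on setT f ->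
     forall x, Xfield sigma i (f \o dil beta lam) x = lam * Xfield sigma i f (dil beta lam x)) ->
  (* the function d *)
  continuous d ->
  smooth_on (~` [set 0]) d ->
  (forall x, d x = 0 <-> x = 0) ->
  (forall x, 0 <= d x) ->
  (forall (lam : R) x, 0 < lam -> d (dil beta lam x) = lam * d x) ->
  (let Q := \sum_(j < N) beta j in
   forall q : R, 2 <= q ->
     (q != Q -> Lp_harmonic sigma q (~` [set 0]) (fun x => d x `^ ((q - Q) / (q - 1)))) /\
     (q = Q -> Lp_harmonic sigma q (~` [set 0]) (fun x => - ln (d x)))) ->
  (* the data of the theorem *)
  2 <= p -> 0 <= alpha -> 0 < Rad ->
  (* z0 = first positive zero of J_0 *)
  0 < z0 -> besselJ0 z0 = 0 -> (forall x, 0 < x < z0 -> besselJ0 x != 0) ->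
  let Q := \sum_(j < N) beta j in
  let B := [set x | d x <= Rad] in
  forall u : 'rV[R]_N -> R, Cc_infty (B `\ 0) u ->
  let gu := gradL sigma u in
  let gd := gradL sigma d in
  let c := `|(Q - p * theta) / p| in
  (integral_on B (fun x => (
      enorm (gu x) `^ p / d x `^ (p * (theta - 1)) * enorm (gd x) `^ alpha)%R)
   >= integral_on B (fun x => (
      `|edot (gu x) (fun i => gd x i / enorm (gd x))| `^ p
        * enorm (gd x) `^ alpha / d x `^ (p * (theta - 1)))%R))%E /\
  (integral_on B (fun x => (
      `|edot (gu x) (fun i => gd x i / enorm (gd x))| `^ p
        * enorm (gd x) `^ alpha / d x `^ (p * (theta - 1)))%R)
   >= (c `^ p)%:E * integral_on B (fun x => (
         `|u x| `^ p / d x `^ (p * theta) * enorm (gd x) `^ (alpha + p))%R)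
      + (2 / p * c `^ (p - 2) * z0 ^+ 2 / Rad ^+ 2)%:E * integral_on B (fun x => (
         `|u x| `^ p / d x `^ (p * theta - 2) * enorm (gd x) `^ (alpha + p))%R))%E.
Proof.
move=> _ csigma _ _ _ _ cd sd d0 d_ge0 _ harmonic p2 alpha0 Rad0 z00 _ hJ Q B u
  [su [K [cK KB uK]]] gu gd c.
split.
  apply: le_integral_on => x.
  rewrite [leRHS]mulrAC ler_wpM2r ?invr_ge0 ?powR_ge0// ler_wpM2r ?powR_ge0//.
  rewrite ge0_ler_powR ?nnegrE ?enorm_ge0//; last exact: edot_unit_le.
  by move: p2; lra.
have p0 : 0 < p by move: p2; lra.
have pN0 : p != 0 by rewrite gt_eqF.
have KB' x : ~ B x -> ~ K x by move=> nB /KB[].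
have up0 x : ~ B x -> `|u x| `^ p = 0.
  by move=> /KB' /uK ->; rewrite normr0 powR0.
have gu0 x i : ~ K x -> gu x i = 0.
  move=> Kx; apply: (@gradL_eq0 _ _ _ sigma (~` K) u x i) => //.
  by apply: closed_openC; apply: compact_closed cK; exact: norm_hausdorff.
rewrite !integral_onE => [|x Bx|x Bx|x Bx]; last 3 first.
- rewrite edotC (edot0r _ (w := gu x)) => [|i]; last exact: gu0 (KB' _ Bx).
  by rewrite normr0 powR0// !mul0r.
- by rewrite up0// !mul0r.
- by rewrite up0// !mul0r.
have hardy k : 0 < k < z0 / Rad -> exists (Rp : R) (E : R -> R),
    (forall x, K x -> 0 < d x < Rp) /\
    (forall r, 0 < r < Rp ->
      is_derive r 1 E (- (E r / r) - p / 2 * E r ^+ 2 - 2 / p * k ^+ 2)).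
  move=> /andP[k0 kz]; have [E dE] := bessel_riccati p0 k0 hJ.
  (* As [k < z0 / Rad], the radius [z0 / k] exceeds [Rad], so the closed ball lies strictly inside
     the first zero of [J_0(k r)]. *)
  exists (z0 / k), E; split => // x /KB[/= dx x0].
  rewrite lt_def d_ge0 andbT (le_lt_trans dx) ?andbT; last first.
    by rewrite ltr_pdivlMr// mulrC -ltr_pdivlMr.
  by apply/eqP => /d0.
have k00 : 0 < z0 / Rad by rewrite divr_gt0.
have half : 0 < z0 / Rad / 2 < z0 / Rad by move: k00; lra.
(* The two weighted integrals do not involve [k]; any admissible value, here half the limit, shows
   them finite. *)
have [Rp [E [Kd _]]] := hardy _ half.
have [I1 I1E] := integral_weight_finite csigma cd sd d0 p2 alpha0 su cK Kd uK (p * theta).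
have [I2 I2E] := integral_weight_finite csigma cd sd d0 p2 alpha0 su cK Kd uK (p * theta - 2).
rewrite I1E I2E -!EFinM -EFinD.
have -> : 2 / p * c `^ (p - 2) * z0 ^+ 2 / Rad ^+ 2 * I2 =
    2 / p * c `^ (p - 2) * I2 * (z0 / Rad) ^+ 2.
  by field; rewrite pN0 gt_eqF.
apply: le_ereal_quadratic_lim => // k /hardy[Rk [Ek [Kdk dEk]]].
have := weighted_hardy csigma cd sd d0 d_ge0 harmonic p2 alpha0 su cK Kdk uK dEk I1E I2E.
by rewrite mulrAC.
Qed.
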